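(* Let $p$ be an odd prime. The set of BG-symbols of BG-partitions coincides with the set of Mullineux symbols of self-Mullineux partitions: $\{\mathcal{BG}_p(\lambda) : \lambda \text{ a BG-partition}\} = \{G_p(\mu) : \mu \text{ a self-Mullineux partition}\}$. Consequently the map sending a BG-partition $\lambda$ to the unique $p$-regular partition $\mu$ with $G_p(\mu)=\mathcal{BG}_p(\lambda)$ is a bijection from the set of BG-partitions onto the set of self-Mullineux partitions, and for every $n\in\mathbb{N}$ it restricts to a bijection from the set of BG-partitions of $n$ onto the set of self-Mullineux partitions of $n$.
   Context: Partitions: a partition $\lambda=(\lambda_1\ge\lambda_2\ge\cdots)$ of non-negative integers with finitely many nonzero parts; $|\lambda|=\sum\lambda_i$; $l(\lambda)$ is the number of nonzero parts. Its Young diagram is $[\lambda]=\{(i,j): i\ge 1, 1\le j\le\lambda_i\}$ (elements are nodes; $i$ indexes rows downward, $j$ columns rightward). $\lambda'$ is the conjugate partition ($\lambda'_j=\#\{i:\lambda_i\ge j\}$); $\lambda$ is self-conjugate if $\lambda=\lambda'$. $k(\lambda)=\max\{i:\lambda_i\ge i\}$; the diagonal nodes are $(i,i)$, $1\le i\le k(\lambda)$. The hook length at $(i,j)\in[\lambda]$ is $h_{ij}=\lambda_i+\lambda'_j-i-j+1$. $\lambda$ is $p$-regular if no nonzero part is repeated $p$ or more times. A BG-partition is a self-conjugate partition with $p\nmid h_{ii}$ for all $1\le i\le k(\lambda)$. Rim and $p$-rim: the rim of $\lambda$ is the set of nodes $(i,j)\in[\lambda]$ with $(i+1,j+1)\notin[\lambda]$.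 Label the rim nodes $1,2,3,\dots$ consecutively along the rim path starting at $(1,\lambda_1)$ and going towards $(l(\lambda),1)$ (from top-right to bottom-left, each next node being the node directly below if it lies in the rim path, otherwise the node to the left). The first $p$-segment consists of the rim nodes with labels $1,\dots,p$ (or all if fewer). If the last node $(i,j)$ of a $p$-segment lies in the last row of $[\lambda]$, stop; otherwise, with $l$ the smallest label in row $i+1$, the next $p$-segment consists of the rim nodes with labels $l,\dots,l+p-1$ (or up to the last label). The $p$-rim of $\lambda$ is the union of all $p$-segments. Mullineux symbol and map: for a $p$-regular $\lambda$ put $\lambda^{(0)}=\lambda$ and $\lambda^{(i)}=\lambda^{(i-1)}\setminus\{p\text{-rim of }\lambda^{(i-1)}\}$, with $l$ maximal such that $\lambda^{(l)}\neq\emptyset$. Let $a_i$ be the number of nodes of the $p$-rim of $\lambda^{(i)}$ and $r_i=l(\lambda^{(i)})$. The Mullineux symbol is the array $G_p(\lambda)=\begin{pmatrix}a_0&\cdots&a_l\\ r_0&\cdots&r_l\end{pmatrix}$; distinct $p$-regular partitions have distinct Mullineux symbols. With $\varepsilon_i=0$ if $p\mid a_i$ and $\varepsilon_i=1$ otherwise, and $s_i=a_i+\varepsilon_i-r_i$, the array $\begin{pmatrix}a_0&\cdots&a_l\\ s_0&\cdots&s_l\end{pmatrix}$ is the Mullineux symbol of a unique $p$-regular partition $m(\lambda)$ (the Mullineux map). $\lambda$ is self-Mullineux if it is $p$-regular and $m(\lambda)=\lambda$. $p$-rim* and BG-symbol: for a nonempty self-conjugate $\lambda$ let $U_\lambda=\{(i,j)\in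 p\text{-rim of }\lambda: i\le j\}$, $L_\lambda=\{(j,i):(i,j)\in U_\lambda\}$, and the $p$-rim* $\mathrm{Rim}^*_p(\lambda)=U_\lambda\cup L_\lambda$. Set $a^*_\lambda=\#\mathrm{Rim}^*_p(\lambda)$, $r^*_\lambda=\#U_\lambda$, $\varepsilon^*_\lambda=a^*_\lambda \bmod 2$. Put $\lambda^{(0)*}=\lambda$ and $\lambda^{(i)*}=\lambda^{(i-1)*}\setminus \mathrm{Rim}^*_p(\lambda^{(i-1)*})$ (again self-conjugate), with $l$ maximal such that $\lambda^{(l)*}\ne\emptyset$; write $a^*_i=a^*_{\lambda^{(i)*}}$, $r^*_i=r^*_{\lambda^{(i)*}}$. The BG-symbol is $\mathcal{BG}_p(\lambda)=\begin{pmatrix}a^*_0&\cdots&a^*_l\\ r^*_0&\cdots&r^*_l\end{pmatrix}$. *)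

(* Defs.v *)
From mathcomp Require Import all_boot.
Set Implicit Arguments. Unset Strict Implicit. Unset Printing Implicit Defensive.

Definition node := (nat * nat)%type.

Definition is_partition (la : seq nat) : bool :=
  sorted geq la && all (fun x => 0 < x) la.

Definition part (la : seq nat) (i : nat) : nat := nth 0 la i.-1.

Definition conj_part (la : seq nat) : seq nat :=
  [seq count (fun x => j <= x) la | j <- iota 1 (head 0 la)].

Definition self_conj (la : seq nat) : bool := conj_part la == la.

(* Young diagram membership, nodes (i,j) 1-indexed *)
Definition in_diag (la : seq nat) (x : node) : bool :=
  [&& 0 < x.1, 0 < x.2 & x.2 <= part la x.1].

Definition kdiag (la : seq nat) : nat :=
  foldr maxn 0 [seq i <- iota 1 (size la) | i <= part la i].

Definition hook (la : seq nat) (i j : nat) : nat :=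
  (part la i + part (conj_part la) j).+1 - i - j.

Definition p_regular (p : nat) (la : seq nat) : bool :=
  is_partition la && all (fun k => count_mem k la < p) la.

Definition is_BG (p : nat) (la : seq nat) : bool :=
  [&& is_partition la, self_conj la &
      all (fun i => ~~ (p %| hook la i i)) (iota 1 (kdiag la))].

Definition in_rim (la : seq nat) (x : node) : bool :=
  in_diag la x && ~~ in_diag la (x.1.+1, x.2.+1).

Fixpoint rim_walk (la : seq nat) (fuel : nat) (x : node) : seq node :=
  match fuel with
  | 0 => [::]
  | f.+1 =>
      if in_rim la x then
        x :: (if in_rim la (x.1.+1, x.2) then rim_walk la f (x.1.+1, x.2)
              else rim_walk la f (x.1, x.2.-1))
      else [::]
  end.

(* rim nodes in label order: the k-th element (0-indexed) has label k+1 *)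
Definition rim_seq (la : seq nat) : seq node :=
  rim_walk la (sumn la) (1, head 0 la).

(* 0-indexed positions in [rim] of the nodes of the p-segments; [l] is the
   number of rows, [start] the position of the first node of the segment *)
Fixpoint psegs (p : nat) (rim : seq node) (l fuel start : nat) : seq nat :=
  match fuel with
  | 0 => [::]
  | f.+1 =>
      let seg := iota start (minn p (size rim - start)) in
      if seg is [::] then [::] else
      let lastn := nth (0, 0) rim (last start seg) in
      if l <= lastn.1 then seg
      else seg ++ psegs p rim l f (find (fun y : node => y.1 == lastn.1.+1) rim)
  end.

Definition prim (p : nat) (la : seq nat) : seq node :=
  let r := rim_seq la in
  [seq nth (0, 0) r k | k <- psegs p r (size la) (size r) 0].

Definition remove_nodes (la : seq nat) (S : seq node) : seq nat :=
  [seq x <- [seq count (fun j => (i, j) \notin S) (iota 1 (part la i))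
            | i <- iota 1 (size la)] | 0 < x].

(* Mullineux symbol: list of columns (a_i, r_i) *)
Fixpoint msym_aux (p fuel : nat) (la : seq nat) : seq (nat * nat) :=
  match fuel with
  | 0 => [::]
  | f.+1 =>
      if la is [::] then [::] else
      (size (undup (prim p la)), size la)
        :: msym_aux p f (remove_nodes la (prim p la))
  end.

Definition mull_symbol (p : nat) (la : seq nat) : seq (nat * nat) :=
  msym_aux p (sumn la) la.

Definition mull_dual_symbol (p : nat) (la : seq nat) : seq (nat * nat) :=
  [seq (c.1, c.1 + (~~ (p %| c.1)) - c.2) | c <- mull_symbol p la].

(* mu = m(la): mu is the (unique) p-regular partition whose Mullineux symbol
   is the array (a_i ; s_i) of la *)
Definition is_mullineux_image (p : nat) (la mu : seq nat) : bool :=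
  p_regular p mu && (mull_symbol p mu == mull_dual_symbol p la).

Definition self_mullineux (p : nat) (la : seq nat) : bool :=
  p_regular p la && is_mullineux_image p la la.

Definition U_rim (p : nat) (la : seq nat) : seq node :=
  undup [seq x <- prim p la | x.1 <= x.2].

Definition rim_star (p : nat) (la : seq nat) : seq node :=
  undup (U_rim p la ++ [seq (x.2, x.1) | x <- U_rim p la]).

Fixpoint bgsym_aux (p fuel : nat) (la : seq nat) : seq (nat * nat) :=
  match fuel with
  | 0 => [::]
  | f.+1 =>
      if la is [::] then [::] else
      (size (rim_star p la), size (U_rim p la))
        :: bgsym_aux p f (remove_nodes la (rim_star p la))
  end.

Definition BG_symbol (p : nat) (la : seq nat) : seq (nat * nat) :=
  bgsym_aux p (sumn la) la.

(* Main.v *)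
(** Encode a partition with rows [la_1 >= ... >= la_l] by its beta numbers
    [b_i = la_i + (l - i)], a strictly decreasing list of positive integers. Each
    p-segment of the rim starts at the end of a row, and removing it lowers the beta
    number [c] of that row to [c - p], or to [0] when it reaches the last row; the
    next segment starts at the largest beta number [<= c - p]. So one step of the
    Mullineux symbol is a greedy map on lists. This map is inverted from the bottom
    up, once the number of removed nodes is known modulo [p], because the top of a
    segment is the least available value above the chain built so far. Comparing the
    chain of a list with that of its image shows that consecutive columns of a
    symbol satisfy inequalities confining [a] to an interval of length [p], hence
    symbols are exactly the arrays satisfying these inequalities.

    For a self-conjugate partition the same greedy map acts on the numbers
    [la_i - i + 1 > 0], of which the diagonal hook lengths are [2 e - 1], with the
    final [0] dropped instead of shifting the list. Since the map only changes these
    numbers by [p], the condition on the hooks is preserved, and it says that [a*] is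
    even exactly when [p] divides it. On an array with [a + eps = 2 r] the
    inequalities for the two kinds of symbols coincide. *)
Require Import Defs.
From mathcomp Require Import all_boot zify.
Set Implicit Arguments. Unset Strict Implicit. Unset Printing Implicit Defensive.

(** * The greedy chain on strictly decreasing lists *)

(* [c] is the last chosen element, not yet lowered; [c - p] is emitted just before
   the next chosen element, so that the output stays sorted. *)
Fixpoint shift (p c : nat) (s : seq nat) : seq nat :=
  if s is x :: s' then
    if x + p <= c then (c - p) :: shift p x s' else x :: shift p c s'
  else [:: c - p].

Fixpoint cost (p c : nat) (s : seq nat) : nat :=
  if s is x :: s' then if x + p <= c then p + cost p x s' else cost p c s'
  else minn p c.

(* The rim node of content [j - i] in a partition with [l] rows is numbered
   [v = j + l - i], so that a p-segment starting in a row with beta number [c]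
   consists of the values in [(c - p, c]]. *)
Definition seg (p c : nat) : seq nat := rev (iota (c - p).+1 (minn p c)).

Fixpoint vals (p c : nat) (s : seq nat) : seq nat :=
  if s is x :: s' then
    if x + p <= c then seg p c ++ vals p x s' else vals p c s'
  else seg p c.

(* Inverse of [shift], reading [l] from the bottom; [t] is the size of the last
   segment. *)
Fixpoint unshift (p t : nat) (l : seq nat) : nat * seq nat :=
  match l with
  | [::] => (0, [::])
  | [:: y] => (y + t, [::])
  | y :: l' =>
      let: (c, s) := unshift p t l' in
      if c <= y then (y + p, c :: s) else (c, y :: s)
  end.

(* The residue of [a > 0] in [1 .. p]: the size of the last segment when [a] nodes
   are removed. *)
Definition res (p a : nat) : nat := (a.-1 %% p).+1.

Lemma res_addl p a : 0 < a -> res p (p + a) = res p a.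
Proof. by case: a => // a _; rewrite /res addnS /= modnDl. Qed.

Lemma res_small p t : 0 < t <= p -> res p t = t.
Proof. by case: t => //= t tp; rewrite /res /= modn_small. Qed.

Lemma path_gtn_leq a b s : a <= b -> path gtn a s -> path gtn b s.
Proof. by case: s => //= x s ab /andP[xa ->]; rewrite andbT; move: xa => /=; lia. Qed.

Lemma path_gtn_all a s : path gtn a s -> all (gtn a) s.
Proof. by apply: order_path_min => x y z /=; lia. Qed.

Lemma cost_gt0 p c s : 0 < p -> 0 < c -> all (leq 1) s -> 0 < cost p c s.
Proof. by move=> p0; elim: s c => [|x s IH] c c0 /= => [_|/andP[x0 s0]]; [lia|case: ifP => _; [lia|exact: IH]]. Qed.

Lemma size_shift p c s : size (shift p c s) = (size s).+1.
Proof. by elim: s c => //= x s IH c; case: ifP => _ /=; rewrite IH. Qed.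

Lemma sumn_shift p c s : c + sumn s = cost p c s + sumn (shift p c s).
Proof.
elim: s c => [|x s IH] c /=; first by lia.
by case: ifP => h /=; [have := IH x | have := IH c]; lia.
Qed.

Lemma path_shift p b c s : 0 < p -> all (leq 1) s -> c - p < b -> path gtn b s ->
  path gtn b (shift p c s).
Proof.
move=> p0; elim: s b c => [|x s IH] b c /=; first by lia.
move=> /andP[x0 s0] cb /andP[xb xs]; case: ifP => h /=.
  rewrite cb /=; apply: IH => //; first by lia.
  by apply: path_gtn_leq xs; lia.
by rewrite xb /=; apply: IH => //; lia.
Qed.

Lemma sub_mem_shift p c s : c - p \in shift p c s.
Proof.
elim: s => [|x s IH] /=; first by rewrite inE.
by case: ifP => _; rewrite inE ?eqxx // IH orbT.
Qed.

Lemma mem_seg p c v : (v \in seg p c) = (c - p < v <= c).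
Proof. by rewrite mem_rev mem_iota; lia. Qed.

Lemma mem_vals_leq p c s v : path gtn c s -> v \in vals p c s -> v <= c.
Proof.
elim: s c => [|x s IH] c /=; first by rewrite mem_seg => _ /andP[].
case/andP=> xc xs; case: ifP => h.
  by rewrite mem_cat mem_seg => /orP[/andP[]//|/(IH _ xs)]; move: xc => /=; lia.
by apply: IH; apply: path_gtn_leq xs; move: xc => /=; lia.
Qed.

Lemma size_vals p c s : size (vals p c s) = cost p c s.
Proof.
elim: s c => [|x s IH] c /=; first by rewrite size_rev size_iota.
by case: ifP => h; rewrite ?size_cat ?IH // size_rev size_iota; lia.
Qed.

(** The segments are disjoint, and lowering [c] to [c - p] changes the count by one exactly when [v]
    lies in [(c - p, c]]. *)
Lemma count_shift p c s v : 0 < v -> path gtn c s ->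
  count (leq v) (c :: s) = count (leq v) (shift p c s) + (v \in vals p c s).
Proof.
move=> v0; elim: s c => [|x s IH] c /=; first by rewrite mem_seg; lia.
case/andP=> xc xs; case: ifP => h /=.
  have := IH x xs; have := @mem_vals_leq p x s v xs.
  by rewrite mem_cat mem_seg /=; case: (v \in vals _ _ _) => /=; lia.
have /IH /= : path gtn c s by apply: path_gtn_leq xs; move: xc => /=; lia.
by lia.
Qed.

(** All segments but the last have size [p], so the residue of the cost is the size of the last one.
    Going up, an entry is a lowered chain element exactly when it is at least the chain element
    found so far. *)
Lemma shiftK p c s : 0 < p -> 0 < c -> all (leq 1) s -> path gtn c s ->
  unshift p (res p (cost p c s)) (shift p c s) = (c, s).
Proof.
move=> p0; elim: s c => [|x s IH] c c0 /=.
  by move=> _ _; rewrite res_small ?subnK; try lia; congr (_, [::]); lia.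
case/andP=> x0 s0 /andP[xc xs].
have cs : path gtn c s by apply: path_gtn_leq xs; move: xc => /=; lia.
have ne d : exists y l, shift p d s = y :: l.
  by case: (shift p d s) (size_shift p d s) => // y l _; exists y, l.
case: ifP => h.
  rewrite res_addl ?cost_gt0 //.
  have [y [l e]] := ne x; have := IH x x0 s0 xs; rewrite e /= => ->.
  by rewrite ifT; [congr (_, _ :: _); lia|lia].
have [y [l e]] := ne c; have := IH c c0 s0 cs; rewrite e /= => ->.
by rewrite ifF //; move: xc => /=; lia.
Qed.

(** A last segment shorter than [p] must end at [0]. [Q] is carried through the inversion:
    positivity for Mullineux symbols, joined by the hook condition for BG-symbols. *)
Lemma unshiftP (Q : pred nat) p t l c s :
    0 < p -> 0 < t <= p -> l != [::] -> sorted gtn l ->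
    (t < p -> last 0 l = 0) -> (forall y, 0 < y -> y \in l -> Q y && Q (y + p)) ->
    Q (last 0 l + t) -> unshift p t l = (c, s) ->
  [/\ shift p c s = l, path gtn c s, res p (cost p c s) = t & all Q (c :: s)].
Proof.
move=> p0 tp lN ls tl Ql Qt u.
(* The added bounds relative to the head of [l] show that [shift] makes the choice that [unshift]
   undoes. *)
suff [] : [/\ shift p c s = l, path gtn c s, res p (cost p c s) = t & all Q (c :: s)] /\
   [/\ path gtn (head 0 l).+1 s, c <= head 0 l + p, all (leq 1) s & 0 < c] by [].
elim: l lN ls tl Ql Qt c s u => // y l IH _.
case: l IH => [|y' l] IH.
  move=> _ /= tl _ Qt c s [<- <-] /=; rewrite Qt.
  have h : (t == p) || (y == 0) by case: eqP => //= ?; rewrite tl //; lia.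
  split; split => //; try lia; first by congr [:: _]; lia.
  by rewrite -[RHS](@res_small p t) //; congr res; lia.
move=> /andP[/= yy ls] tl Ql Qt c s.
case E: (unshift p t (y' :: l)) => [c1 s1].
have Ql' z : 0 < z -> z \in y' :: l -> Q z && Q (z + p).
  by move=> z0 zl; apply: Ql; rewrite // inE zl orbT.
have /andP[Qy Qyp] : Q y && Q (y + p) by apply: Ql; rewrite ?mem_head //; lia.
have {IH}[[i1 i2 i3 i4] [i5 i6 i7 i8]] := IH isT ls tl Ql' Qt _ _ E.
move: E i6 i5 i4; rewrite /= => -> /= i6 i5 /andP[Qc Qs].
case: ifP => h [<- <-]; split.
- rewrite /= leq_add2r h addnK i1 Qyp Qc Qs res_addl ?cost_gt0 //.
  by split=> //; rewrite i2 andbT; lia.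
- by split=> //=; rewrite ?i8 ?i2 ?andbT; lia.
- have e : (y + p <= c1) = false by lia.
  rewrite /= Qc Qy Qs e.
  rewrite i1 i3; split=> //; apply/andP; split; first by lia.
  by apply: path_gtn_leq i5; lia.
- split=> //=; rewrite ?i7; try lia.
  by rewrite leqnn /=; apply: path_gtn_leq i5; lia.
Qed.

Lemma mem_shift_lt p c s y : 0 < p -> 0 < c -> all (leq 1) s -> path gtn c s ->
  y \in shift p c s -> y < c.
Proof.
move=> p0 c0 s0 cs yl.
have /path_gtn_all/allP : path gtn c (shift p c s) by apply: path_shift => //; lia.
by move=> /(_ _ yl).
Qed.

(** * Comparison of the cost of a list with the cost of its image *)

(* [pcost] is [a + eps] in the notation of the Mullineux symbol, see [pcost1]. *)
Fixpoint pcost (p c : nat) (s : seq nat) : nat :=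
  if s is x :: s' then if x + p <= c then p + pcost p x s' else pcost p c s'
  else minn p c.+1.

Lemma rev_iotaS z : rev (iota 0 z.+1) = z :: rev (iota 0 z).
Proof. by rewrite -[z.+1]addn1 iotaD rev_cat. Qed.

(** An image without gaps forces abutting segments: the entries after [c - p] stay below the next
    chosen [x <= c - p], so [c - p = x], and the segments fill [[1, c]]. *)
Lemma initial_shift_cost p z c s : 0 < p -> 0 < c -> all (leq 1) s -> path gtn c s ->
  shift p c s = rev (iota 0 z) -> cost p c s = c.
Proof.
move=> p0; elim: s c z => [|x s IH] c [|z] c0 s0 cs //.
- by rewrite rev_iotaS /= => -[]; case: z => // [|z]; [lia | rewrite rev_iotaS].
- by move/(congr1 size); rewrite size_shift.
move: s0 cs; rewrite rev_iotaS /= => /andP[x0 s0] /andP[xc xs].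
case: ifP => h [].
  move=> cz e; rewrite (IH x z) //.
  case: z cz e => [|z] cz e; first lia.
  have : z \in shift p x s by rewrite e mem_rev mem_iota; lia.
  by move/(mem_shift_lt p0 x0 s0 xs); lia.
by move=> _ e; rewrite (IH c z) //; apply: path_gtn_leq xs; lia.
Qed.

(* [c] and [c'] are the current elements of the chain of [c :: s] and of the chain of
   its image. The two chains interlace: either [c] is one step ahead, [c <= c'], or
   both are level, [c - p <= c' < c]. *)
Lemma range_above p z c' c s l :
    0 < p -> 0 < c -> all (leq 1) s -> path gtn c s -> z < c' -> c <= c' + p ->
    shift p c s = l ++ rev (iota 0 z) -> all (leq z.+1) l ->
  pcost p (c' - z) [seq y - z | y <- l] + z <= cost p c s + p * (c <= c')
    < pcost p (c' - z) [seq y - z | y <- l] + z + p.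
Proof.
move=> p0; elim: s c c' l => [|x s IH] c c' l c0 s0 cs zc' cc'.
  case: l => [|y l].
    move=> e _.
    have k := initial_shift_cost p0 c0 s0 cs e; move: e.
    have : c - p \in shift p c [::] by rewrite mem_head.
    have : size (shift p c [::]) = 1 by [].
    by move=> + + e; rewrite k e mem_rev mem_iota size_rev size_iota /=; lia.
  case: l => [|//] /= [<-]; case: z zc' => [|z] zc'; last by rewrite rev_iotaS.
  by move=> _ /andP[h _]; rewrite !subn0; case: ifP; lia.
case: l => [|y l] e.
  move=> _; rewrite (initial_shift_cost p0 c0 s0 cs e).
  have : c - p \in shift p c (x :: s) by apply: sub_mem_shift.
  have : size (shift p c (x :: s)) = (size s).+2 by rewrite size_shift.
  rewrite e mem_rev mem_iota size_rev size_iota => zs.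
  have : z.-1 \in shift p c (x :: s) by rewrite e mem_rev mem_iota; lia.
  by move/(mem_shift_lt p0 c0 s0 cs) => /=; lia.
move: s0 cs => /= /andP[x0 s0] /andP[xc xs] /andP[zy zl].
move: e => /=; case: ifP => h [yE e]; rewrite -{}yE in zy *.
  have zx : z <= x.
    case: (posnP z) => [->//|z0].
    have : z.-1 \in shift p x s by rewrite e mem_cat mem_rev mem_iota; lia.
    by move/(mem_shift_lt p0 x0 s0 xs); lia.
  (* Whether or not the image chain takes [c - p], the new pair has [x] one step ahead. *)
  case: ifP => h2.
    have cxp : x <= c - p by lia.
    by have := IH x (c - p) l x0 s0 xs zy _ e zl; rewrite cxp; lia.
  have xc' : x <= c' by lia.
  by have := IH x c' l x0 s0 xs zc' _ e zl; rewrite xc'; lia.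
have cs : path gtn c s by apply: path_gtn_leq xs; lia.
(* If the image chain takes the kept entry [x], the chains become level, since [x < c < x + p]. *)
case: ifP => h2; last by apply: IH.
have cx : (c <= x) = false by lia.
by have := IH c x l c0 s0 cs zy _ e zl; rewrite cx; lia.
Qed.

(** The interlacing argument of [range_above], with a final [0] dropped instead of a bottom run
    removed; [e] is 1 when the last segment reaches [0], and 0 otherwise. *)
Lemma range_positive p c' c s :
    0 < p -> 0 < c -> all (leq 1) s -> path gtn c s -> 0 < c' -> c <= c' + p ->
  let l := [seq y <- shift p c s | 0 < y] in
  let e := size (shift p c s) - size l in
  cost p c' l + e <= cost p c s + p * (c <= c') < cost p c' l + e + p.
Proof.
move=> p0; elim: s c c' => [|x s IH] c c' c0 s0 cs c'0 cc' /=.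
  by case: ifP => /= h; [case: ifP|]; lia.
move: s0 cs => /= /andP[x0 s0] /andP[xc xs].
case: ifP => h /=.
  rewrite ifT /=; last lia.
  case: ifP => h2.
    have cxp : x <= c - p by lia.
    by have := IH x (c - p) x0 s0 xs; rewrite cxp /=; lia.
  have xc' : x <= c' by lia.
  by have := IH x c' x0 s0 xs c'0; rewrite xc' /=; lia.
have cs : path gtn c s by apply: path_gtn_leq xs; lia.
rewrite x0 /= subSS; case: ifP => h2; last by apply: IH.
have cx : (c <= x) = false by lia.
by have := IH c x c0 s0 cs x0; rewrite cx /=; lia.
Qed.

(** The cost is divisible by [p] exactly when the last segment is full; a last segment of size
    [c < p] counts [c + 1] in [pcost]. *)
Lemma pcost1 p c s : 0 < p -> 0 < c -> all (leq 1) s ->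
  pcost p c s = cost p c s + ~~ (p %| cost p c s).
Proof.
move=> p0; elim: s c => [|x s IH] c c0 /=.
  move=> _; case: (leqP p c) => h; first by rewrite dvdnn; lia.
  by rewrite gtnNdvd; lia.
case/andP=> x0 s0; case: ifP => _; last exact: IH.
by rewrite IH // dvdn_addr ?dvdnn // addnA.
Qed.

Lemma last_shift p c s : ~~ (p %| cost p c s) -> last 0 (shift p c s) = 0.
Proof.
elim: s c => [|x s IH] c /=.
  by case: (leqP p c) => h; rewrite ?dvdnn //; lia.
have lastE y d : last y (shift p d s) = last 0 (shift p d s).
  by case: (shift p d s) (size_shift p d s).
by case: ifP => h; rewrite ?dvdn_addr // => /IH; rewrite /= lastE.
Qed.

Lemma dvdn_cost p c s : 0 \notin shift p c s -> p %| cost p c s.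
Proof.
apply: contraR => /last_shift h.
by rewrite -{1}h; case: (shift p c s) (size_shift p c s) => // y l _; apply: mem_last.
Qed.

Lemma cost_small p c s : 0 < p -> c <= p -> all (leq 1) s -> cost p c s = c.
Proof.
move=> p0 cp; elim: s => [|x s IH] /=; first by lia.
by case/andP=> x0 /IH ->; case: ifP => //; lia.
Qed.

(** [b] is the last chain element: it drops to [0] and contributes [b] to the cost, while each
    earlier one contributes [p]. *)
Lemma mod_cost p c s : 0 < p -> all (leq 1) s -> path gtn c s -> 0 \in shift p c s ->
  exists2 b, b \in c :: s & b <= p /\ exists m, cost p c s = m * p + b.
Proof.
move=> p0; elim: s c => [|x s IH] c /=.
  rewrite inE => _ _ h; exists c; rewrite ?mem_head //; split; first by lia.
  by exists 0; lia.
move=> /andP[x0 s0] /andP[xc xs]; case: ifP => h; rewrite inE.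
  rewrite (_ : (0 == c - p) = false) /=; last by lia.
  case/(IH _ s0 xs) => b bs [bp [m e]]; exists b; first by rewrite inE bs orbT.
  by split=> //; exists m.+1; rewrite e mulSn; lia.
rewrite (_ : (0 == x) = false) /=; last by lia.
have cs : path gtn c s by apply: path_gtn_leq xs; move: xc => /=; lia.
case/(IH _ s0 cs) => b bs h2; exists b => //.
by move: bs; rewrite !inE => /orP[->//|->]; rewrite !orbT.
Qed.

(** * Runs of [p] consecutive values under the greedy map *)

(* [p] consecutive beta numbers are [p] equal parts. *)
Definition window (p x : nat) (l : seq nat) : Prop :=
  forall y, x <= y < x + p -> y \in l.

Lemma mem_shift_small p c s y : 0 < p -> all (leq 1) s -> path gtn c s ->
  0 < y -> y \in shift p c s -> [|| y \in s, y == c - p | y + p <= c - p].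
Proof.
move=> p0; elim: s c => [|x s IH] c /=; first by rewrite inE => _ _ _ ->.
move=> /andP[x0 s0] /andP[xc xs] y0.
have cs : path gtn c s by apply: path_gtn_leq xs; move: xc => /=; lia.
case: ifP => h; rewrite !inE => /orP[/eqP yE|].
- by rewrite -yE eqxx !orbT.
- by move/(IH _ s0 xs y0) => /or3P[->|/eqP yE|yx]; rewrite ?orbT //; apply/orP; right; lia.
- by rewrite yE eqxx.
- by move/(IH _ s0 cs y0) => /or3P[->|->|->]; rewrite ?orbT.
Qed.

(** Entries after [c - p] lie below the next chosen [x <= c - p], so [c - p - 1] can occur only if
    [x = c - p]. *)
Lemma mem_shift_pred p c s y : 0 < p -> all (leq 1) s -> path gtn c s ->
  y.+1 = c - p -> y \in shift p c s -> y.+1 \in s.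
Proof.
move=> p0; elim: s c => [|x s IH] c /=; first by rewrite inE; lia.
move=> /andP[x0 s0] /andP[xc xs] yc.
have cs : path gtn c s by apply: path_gtn_leq xs; move: xc => /=; lia.
case: ifP => h; rewrite !inE => /orP[/eqP|]; try lia.
  by move/(mem_shift_lt p0 x0 s0 xs) => yx; apply/orP; left; lia.
by move=> /(IH _ s0 cs yc) ->; rewrite orbT.
Qed.

Lemma mem_shift_large p c s y : y \in s -> path gtn c s -> c < y + p -> y \in shift p c s.
Proof.
elim: s c => [//|x s IH] c /=; rewrite inE => yxs /andP[xc xs] h.
have yx : y <= x.
  by case/orP: yxs => [/eqP->//|ys]; have /allP/(_ _ ys) := path_gtn_all xs; move=> /=; lia.
rewrite ifF; last lia.
rewrite inE; case: eqP yxs => //= _ ys; apply: IH => //.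
by apply: path_gtn_leq xs; move: xc => /=; lia.
Qed.

(** The next chosen element is [c - p] itself: the lowered [c] takes its place, and the entries less
    than [p] below it are kept. *)
Lemma mem_shift_large2 p c s y : y \in s -> path gtn c s -> 0 < p -> c - p \in s ->
  p <= c -> c - p < y + p -> y \in shift p c s.
Proof.
elim: s c => [//|x s IH] c /=; rewrite !inE => yxs /andP[xc xs] p0 cxs pc h.
have le z : (z == x) || (z \in s) -> z <= x.
  by case/orP=> [/eqP->//|ys]; have /allP/(_ _ ys) := path_gtn_all xs; move=> /=; lia.
have := le _ yxs; have := le _ cxs; move=> cx yx.
have cs : path gtn c s by apply: path_gtn_leq xs; move: xc => /=; lia.
case: ifP => h2; rewrite inE.
  by case: eqP => //= yc; case: eqP yxs => [|_ /= ys]; [|apply: mem_shift_large => //]; lia.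
case: eqP yxs => //= _ ys; case: eqP cxs => [|_ /= cps]; first by lia.
exact: IH.
Qed.

(** Lowered values are at least [p] apart, so a run in the image contains at most one. Either that
    value was already in the list, or it is the bottom of the run, and raising it by [p] moves the
    run up by one. *)
Lemma window_unshift p x c s : 1 < p -> 0 < c -> all (leq 1) s -> path gtn c s -> 0 < x ->
  window p x (shift p c s) -> window p x (c :: s) \/ window p x.+1 (c :: s).
Proof.
move=> p1; have p0 := ltnW p1; elim: s c => [|a s IH] c c0.
  move=> _ _ x0 w; have := w x; have := w x.+1; rewrite !inE; lia.
move=> as0 cas x0 w; move: (as0) (cas) => /= /andP[a0 s0] /andP[ac aS].
have cs : path gtn c s by apply: path_gtn_leq aS; move: ac => /=; lia.
have sub z t (l : seq nat) : window p z (t :: s) -> {subset s <= l} -> t \in l -> window p z l.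
  by move=> w1 sl tl y /w1; rewrite inE => /orP[/eqP->//|/sl].
have wsub z : window p z (a :: s) -> window p z (c :: a :: s).
  by move=> w1 y /w1 h; rewrite inE h orbT.
have csub z : window p z (c :: s) -> window p z (c :: a :: s).
  by move=> w1 y /w1; rewrite !inE => /orP[->|->] //; rewrite !orbT.
move: w => /=; case: ifP => h w.
  have lta y : y \in shift p a s -> y < a by apply: mem_shift_lt.
  case: (ltnP (x + p).-1 (c - p)) => h1.
    have : window p x (shift p a s).
      by move=> y yx; have := w y yx; rewrite inE; case: eqP => //; lia.
    by case/(IH a a0 s0 aS x0) => w1; [left|right]; apply: wsub.
  (* The run has top [c - p], and the value just below it, being less than [a], forces
     [a = c - p]. *)
  have : (x + p).-1 \in c - p :: shift p a s by apply: w; lia.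
  rewrite inE => /orP[/eqP e|/lta]; last by lia.
  have : (x + p).-2 \in c - p :: shift p a s by apply: w; lia.
  rewrite inE => /orP[/eqP e2|/lta e2]; first by lia.
  left; apply: wsub => y yx; rewrite inE; case: eqP => //= ya.
  have : y \in c - p :: shift p a s by apply: w.
  rewrite inE => /orP[/eqP e3|]; first by lia.
  by move/(mem_shift_small p0 s0 aS) => /(_ ltac:(lia)) /or3P[//||]; lia.
have lta y : y \in shift p c s -> y < a.
  move=> yl; have /path_gtn_all/allP/(_ y yl) // : path gtn a (shift p c s).
  by apply: path_shift => //; lia.
case: (leqP (x + p) a) => h1.
  have : window p x (shift p c s).
    by move=> y yx; have := w y yx; rewrite inE; case: eqP => //; lia.
  by case/(IH c c0 s0 cs x0) => w1; [left|right]; apply: csub.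
have : (x + p).-1 \in a :: shift p c s by apply: w; lia.
rewrite inE => /orP[/eqP e|/lta]; last by lia.
have ws y : x <= y < a -> (y \in s) || (y == c - p).
  move=> yx; have : y \in a :: shift p c s by apply: w; lia.
  rewrite inE => /orP[|]; first by lia.
  by move/(mem_shift_small p0 s0 cs) => /(_ ltac:(lia)) /or3P[->//|->|]; [rewrite orbT|move: ac => /=; lia].
case: (ltngtP (c - p) x) => h2.
- left; apply: wsub => y yx; rewrite inE; case: eqP => //= ya.
  by case/orP: (ws y ltac:(lia)) => //; lia.
- left; apply: wsub => y yx; rewrite inE; case: eqP => //= ya.
  case/orP: (ws y ltac:(lia)) => // /eqP ->.
  rewrite -[c - p]prednK; last by lia.
  apply: (@mem_shift_pred p c) => //; first by lia.
  by have := w (c - p).-1 ltac:(lia); rewrite inE => /orP[|//]; lia.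
- right=> y yx; rewrite !inE; case: eqP => //= yc; case: eqP => //= ya.
  by case/orP: (ws y ltac:(lia)) => //; lia.
Qed.

(** With [0] in the image and [p] dividing the cost, the last chain element is exactly [p], and the
    image values in [[1, p - 1]] are kept entries. *)
Lemma window0_unshift p c s : 0 < p -> 0 < c -> all (leq 1) s -> path gtn c s ->
  p %| cost p c s -> window p 0 (shift p c s) -> window p 1 (c :: s).
Proof.
move=> p0 c0 s0 cs pd w.
suff [h1 h2] : p \in c :: s /\ {in shift p c s, forall y, 0 < y < p -> y \in c :: s}.
  move=> y yp; case: (eqVneq y p) => [->//|yp'].
  by apply: h2; [apply: w|]; lia.
have {w} := w 0 ltac:(lia).
elim: s c c0 s0 cs pd => [|a s IH] c c0.
  rewrite /= !inE => _ _; case: (leqP p c) => h.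
    move=> _ e; split; first lia.
    by move=> y; rewrite !inE; lia.
  by rewrite gtnNdvd.
move=> /= /andP[a0 s0] /andP[ac aS].
have cs : path gtn c s by apply: path_gtn_leq aS; move: ac => /=; lia.
case: ifP => h; rewrite inE.
  rewrite dvdn_addr // (_ : (0 == c - p) = false) /=; last by lia.
  move=> pd /(IH a a0 s0 aS pd) [h1 h2]; split; first by rewrite inE h1 orbT.
  move=> y; rewrite inE => /orP[/eqP->|/h2 h3 yp]; last by rewrite inE h3 ?orbT.
  move=> yp; suff : p <= a by lia.
  by move: h1; rewrite inE => /orP[/eqP->//|hp]; have /allP/(_ _ hp) := path_gtn_all aS; move=> /=; lia.
rewrite (_ : (0 == a) = false) /=; last by lia.
move=> pd /(IH c c0 s0 cs pd) [h1 h2]; split.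
  by move: h1; rewrite !inE => /orP[->|->] //; rewrite !orbT.
move=> y; rewrite inE => /orP[/eqP->|/h2 h3 /h3]; first by rewrite !inE eqxx orbT.
by rewrite !inE => /orP[->|->] //; rewrite !orbT.
Qed.

(** If the top of the run is chosen, it drops to just below the bottom and the rest is kept. If it
    is passed over by a chain element [c] above it, the run contains [c - p], which is chosen next
    and whose place the lowered [c] fills. *)
Lemma window_shift p x c s : 1 < p -> 0 < c -> all (leq 1) s -> path gtn c s -> 0 < x ->
  window p x (c :: s) ->
  window p x (shift p c s) \/ window p x.-1 (shift p c s) /\ (x = 1 -> p %| cost p c s).
Proof.
move=> p1; have p0 := ltnW p1; elim: s c => [|a s IH] c c0.
  move=> _ _ x0 w; have := w x; have := w x.+1; rewrite !inE; lia.
move=> as0 cas x0 w.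
have ltc y : y \in a :: s -> y < c by move=> ys; have /allP/(_ _ ys) := path_gtn_all cas.
case: (ltngtP c (x + p).-1) => h1.
- by exfalso; have := w (x + p).-1 ltac:(lia); rewrite inE => /orP[/eqP|/ltc]; lia.
- have {}w y : x <= y < x + p -> y \in a :: s.
    by move=> yx; have := w y yx; rewrite inE => /orP[|//]; lia.
  move: as0 cas => /= /andP[a0 s0] /andP[ac aS].
  have cs : path gtn c s by apply: path_gtn_leq aS; move: ac => /=; lia.
  have lta y : y \in s -> y < a by move=> ys; have /allP/(_ _ ys) := path_gtn_all aS.
  have sub z t (l : seq nat) : window p z l -> window p z (t :: l).
    by move=> w1 y /w1 h; rewrite inE h orbT.
  case: ifP => h.
    case: (IH a a0 s0 aS x0 w) => [w1|[w1 w2]]; [left|right; split]; try exact: sub.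
    by move/w2; rewrite dvdn_addr.
  case: (ltngtP a (x + p).-1) => h2.
  + by exfalso; have := w (x + p).-1 ltac:(lia); rewrite inE => /orP[/eqP|/lta]; lia.
  + have {}w : window p x (c :: s).
      by move=> y yx; have := w y yx; rewrite !inE => /orP[|->]; [lia|rewrite orbT].
    by case: (IH c c0 s0 cs x0 w) => [w1|[w1 w2]]; [left|right; split=> //]; exact: sub.
  left=> y yx; rewrite inE; case: eqP => //= ya.
  have ys : y \in s by have := w y yx; rewrite inE; case: eqP.
  case: (ltnP c (y + p)) => h3; first exact: mem_shift_large.
  apply: mem_shift_large2 => //; try by move: ac => /=; lia.
  by have := w (c - p) ltac:(move: ac => /=; lia); rewrite inE => /orP[|//]; move: ac => /=; lia.
- right; split; last first.
    move=> xE; have cp : c = p by lia.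
    by rewrite (cost_small p0) ?cp ?dvdnn.
  move=> y yx; case: (eqVneq y x.-1) => yE.
    have -> : y = c - p by lia.
    exact: sub_mem_shift.
  apply: mem_shift_large => //; last by lia.
  by have := w y ltac:(lia); rewrite inE => /orP[|//]; lia.
Qed.

(** * Beta numbers and the p-rim *)

Fixpoint beta (la : seq nat) : seq nat :=
  if la is x :: s then x + size s :: beta s else [::].

Fixpoint unbeta (bs : seq nat) : seq nat :=
  if bs is b :: s then b - size s :: unbeta s else [::].

Lemma size_beta la : size (beta la) = size la.
Proof. by elim: la => //= x s ->. Qed.

Lemma size_unbeta bs : size (unbeta bs) = size bs.
Proof. by elim: bs => //= x s ->. Qed.

Lemma betaK la : unbeta (beta la) = la.
Proof. by elim: la => //= x s ->; rewrite size_beta addnK. Qed.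

Lemma beta_strict la : is_partition la -> sorted gtn (beta la) && all (leq 1) (beta la).
Proof.
case/andP; case: la => // x s; elim: s x => [|y s IH] x /=; first by lia.
case/andP=> yx ys /andP[x0 ys0]; have := IH y ys ys0; rewrite /= => /andP[-> /andP[-> ->]].
by move: yx => /=; lia.
Qed.

Lemma size_strict b s : path gtn b s -> all (leq 1) (b :: s) -> size s < b.
Proof.
elim: s b => [|x s IH] b /=; first by lia.
by case/andP=> /= xb xs /andP[_ s0]; have := IH x xs s0; lia.
Qed.

Lemma unbetaK bs : sorted gtn bs -> all (leq 1) bs -> beta (unbeta bs) = bs.
Proof.
case: bs => // b s /=; elim: s b => [|x s IH] b; first by rewrite /= addn0 subn0.
move=> bxs b0; have := size_strict bxs b0; case/andP: bxs b0 => xb xs /andP[b0 s0] h.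
by have := IH x xs s0; rewrite /= size_unbeta => ->; rewrite subnK //; move: h => /=; lia.
Qed.

Lemma unbeta_partition bs : sorted gtn bs -> all (leq 1) bs -> is_partition (unbeta bs).
Proof.
rewrite /is_partition; case: bs => // b s /=; elim: s b => [|x s IH] b /=; first by lia.
case/andP=> /= xb xs /andP[b0 xs0]; have := IH x xs xs0.
have := size_strict xs xs0.
by case/andP: xs0 => x0 s0 ? /andP[-> /andP[-> ->]]; move: xb => /=; lia.
Qed.

Lemma nth_beta la k : k < size la -> nth 0 (beta la) k = nth 0 la k + (size la - k.+1).
Proof. by elim: la k => //= x s IH [|k] /= ks; [rewrite subSS subn0|rewrite IH]. Qed.

(** * Young diagrams and node removal through counts of beta numbers *)

Lemma count_leq_nth s v i : sorted geq s -> 0 < v -> 0 < i ->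
  (i <= count (leq v) s) = (v <= nth 0 s i.-1).
Proof.
move=> ss v0; case: i => // i _ /=; elim: s i ss => [|a s IH] i /=; first by rewrite nth_nil; lia.
move=> as_; have ss := path_sorted as_; have /allP las := order_path_min (rev_trans leq_trans) as_.
case: (leqP v a) => va.
  by case: i => [|i] /=; rewrite ?va // add1n ltnS IH.
have -> : count (leq v) s = 0.
  by apply/eqP; rewrite -leqn0 leqNgt -has_count; apply/hasPn => y /las /=; lia.
case: i => [|i] /=; first by lia.
case: (ltnP i (size s)) => h; last by rewrite nth_default //; lia.
by have := las _ (mem_nth 0 h); rewrite /=; lia.
Qed.

Lemma gtn_sorted_geq s : sorted gtn s -> sorted geq s.
Proof. by apply: sub_sorted => x y /=; lia. Qed.

(** Row [i] reaches column [j] when its beta number is at least [j + l - i]; as beta numbers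
    decrease, this is a count at a threshold depending only on the diagonal. *)
Lemma in_diag_beta la i j : is_partition la -> 0 < i -> 0 < j ->
  in_diag la (i, j) = (i <= size la) && (i <= count (leq (j + size la - i)) (beta la)).
Proof.
move=> pla i0 j0; rewrite /in_diag /= i0 j0 /= /part.
case: (leqP i (size la)) => h /=; last by rewrite nth_default; lia.
rewrite count_leq_nth //; last by lia.
  by rewrite nth_beta; lia.
by apply: gtn_sorted_geq; case/andP: (beta_strict pla).
Qed.

Lemma count_leq_iota n m : n <= m -> count (fun j => j <= n) (iota 1 m) = n.
Proof.
move=> nm; rewrite -[m](subnKC nm) iotaD count_cat.
have -> : count (fun j => j <= n) (iota 1 n) = n.
  by rewrite -[RHS](size_iota 1 n); apply/eqP; rewrite -all_count; apply/allP => j; rewrite mem_iota; lia.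
suff -> : count (fun j => j <= n) (iota (1 + n) (m - n)) = 0 by rewrite addn0.
by apply/eqP; rewrite -leqn0 leqNgt -has_count; apply/hasPn => y; rewrite mem_iota; lia.
Qed.

Lemma in_diag_pos la x : in_diag la x -> (0 < x.1) && (0 < x.2).
Proof. by case/and3P=> -> ->. Qed.

Lemma map_part la n : [seq part la i | i <- iota 1 n] = mkseq (nth 0 la) n.
Proof. by rewrite /mkseq (iotaDl 1 0 n) -map_comp. Qed.

Lemma partition_nth_gt0 la k : is_partition la -> (0 < nth 0 la k) = (k < size la).
Proof.
case/andP=> _ /allP la0; case: (ltnP k (size la)) => h; last by rewrite nth_default.
exact: la0 (mem_nth _ h).
Qed.

(** [remove_nodes] counts the surviving nodes row by row and drops the emptied rows; when the
    survivors form a diagram, these counts are its parts. *)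
Lemma remove_nodesE la nu S : is_partition la -> is_partition nu ->
  (forall i j, 0 < i -> 0 < j -> in_diag nu (i, j) = in_diag la (i, j) && ((i, j) \notin S)) ->
  remove_nodes la S = nu.
Proof.
move=> pla pnu nuE.
have le i : 0 < i -> part nu i <= part la i.
  move=> i0; case: (posnP (part nu i)) => [->//|h].
  by have := nuE i _ i0 h; rewrite /in_diag /= i0 h leqnn /= => /esym/andP[].
have sz : size nu <= size la.
  case: (posnP (size nu)) => [->//|h].
  have := le _ h; rewrite /part; have := partition_nth_gt0 (size nu).-1 pnu.
  by have := partition_nth_gt0 (size nu).-1 pla; lia.
rewrite /remove_nodes.
have -> : [seq count (fun j => (i, j) \notin S) (iota 1 (part la i)) | i <- iota 1 (size la)]
   = [seq part nu i | i <- iota 1 (size la)].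
  apply/eq_in_map => i; rewrite mem_iota => /andP[i0 _].
  rewrite -[RHS](count_leq_iota (le i i0)); apply/eq_in_count => j; rewrite mem_iota => /andP[j0 ji].
  have := nuE i j i0 j0; rewrite /in_diag /= i0 j0 /= => ->.
  by rewrite (_ : j <= _) //; lia.
rewrite map_part /mkseq -(subnKC sz) iotaD map_cat filter_cat -/(mkseq _ _) mkseq_nth.
have /all_filterP -> : all (leq 1) nu by case/andP: pnu.
rewrite (_ : filter _ _ = [::]) ?cats0 //; apply/eqP; rewrite -[_ == _]negbK -has_filter.
apply/hasPn => x /mapP[k]; rewrite mem_iota => /andP[h _] ->.
by rewrite nth_default.
Qed.

Lemma partition_ext la nu : is_partition la -> is_partition nu ->
  (forall i j, 0 < i -> 0 < j -> in_diag nu (i, j) = in_diag la (i, j)) -> la = nu.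
Proof.
move=> pla pnu h.
rewrite -(@remove_nodesE la la [::] pla pla); last by move=> i j; rewrite andbT.
by apply: remove_nodesE => // i j i0 j0; rewrite andbT h.
Qed.

Definition nodes (la : seq nat) : seq node :=
  [seq (i, j) | i <- iota 1 (size la), j <- iota 1 (part la i)].

Lemma mem_nodes la x : is_partition la -> (x \in nodes la) = in_diag la x.
Proof.
case: x => i j pla; apply/allpairsPdep/idP.
  by case=> i' [j' []]; rewrite !mem_iota => h1 h2 [-> ->]; rewrite /in_diag /=; lia.
case/and3P=> /= i0 j0 h; exists i, j; split=> //; rewrite mem_iota; last by lia.
by have := partition_nth_gt0 i.-1 pla; move: h; rewrite /part; lia.
Qed.

Lemma size_nodes la : size (nodes la) = sumn la.
Proof.
rewrite size_allpairs_dep -[in RHS](mkseq_nth 0 la) -map_part; congr sumn.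
by apply: eq_map => i; rewrite size_iota.
Qed.

Lemma uniq_nodes la : uniq (nodes la).
Proof.
apply: allpairs_uniq_dep; [exact: iota_uniq | by move=> *; exact: iota_uniq |].
by case=> [i j] [i' j'] _ _ /= [-> ->].
Qed.

Lemma sumn_remove la nu S : is_partition la -> is_partition nu ->
  (forall i j, 0 < i -> 0 < j -> in_diag nu (i, j) = in_diag la (i, j) && ((i, j) \notin S)) ->
  uniq S -> {subset S <= in_diag la} -> sumn la = size S + sumn nu.
Proof.
move=> pla pnu nuE uS Sla; rewrite -!size_nodes -size_cat; apply: perm_size.
have nuE' x : in_diag nu x = in_diag la x && (x \notin S).
  case: x => i j; case: (posnP i) => [->|i0]; first by rewrite /in_diag.
  by case: (posnP j) => [->|j0]; [rewrite /in_diag /= andbF|apply: nuE].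
apply: uniq_perm; rewrite ?uniq_nodes ?cat_uniq ?uS ?uniq_nodes ?andbT //=.
  by apply/hasPn => x; rewrite mem_nodes // nuE' => /andP[].
move=> x; rewrite mem_cat !mem_nodes // nuE'; case: (boolP (x \in S)) => /= [/Sla //|_].
by rewrite andbT.
Qed.

(** * The rim and the p-rim as lists of values *)

(** The lowest node of the diagram on the diagonal [j + l - i = v], which is the rim node there. *)
Definition nd (bs : seq nat) (v : nat) : node :=
  (count (leq v) bs, v + count (leq v) bs - size bs).

(** The entries below [v] are distinct and positive, so there are at most [v - 1] of them; hence the
    column of [nd bs v] is positive. *)
Lemma count_leq_ge bs v : sorted gtn bs -> all (leq 1) bs -> 0 < v ->
  size bs < v + count (leq v) bs.
Proof.
elim: bs => [|b s IH] /=; first by lia.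
move=> bs /andP[b0 s0] v0; have := IH (path_sorted bs) s0 v0.
case: (leqP v b) => h; first by lia.
suff : size s < b by lia.
by apply: size_strict => //=; rewrite b0.
Qed.

Lemma count_leq_pred bs v : sorted gtn bs ->
  count (leq v) bs = count (leq v.+1) bs + (v \in bs).
Proof.
elim: bs => //= b s IH bs; rewrite inE IH ?(path_sorted bs) //.
have /allP sb := path_gtn_all bs.
case: (eqVneq v b) => [->|vb] /=; last by lia.
by have -> : (b \in s) = false by [apply/negP => /sb /=; lia]; lia.
Qed.

Lemma rev_iota1S v : rev (iota 1 v.+1) = v.+1 :: rev (iota 1 v).
Proof. by rewrite -[v.+1]addn1 iotaD rev_cat /= add1n addn1. Qed.

Lemma nd_bounds la v : is_partition la -> 0 < v <= head 0 (beta la) ->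
  (0 < (nd (beta la) v).1 <= size la) &&
  (size la < v + (nd (beta la) v).1).
Proof.
move=> pla /andP[v0 vh]; have /andP[bs b0] := beta_strict pla.
have := count_leq_ge bs b0 v0; have := count_size (leq v) (beta la).
rewrite size_beta /nd /= => -> ->; rewrite !andbT.
by case: (beta la) vh => [|c t] /=; lia.
Qed.

Lemma in_rim_nd la v : is_partition la -> 0 < v <= head 0 (beta la) -> in_rim la (nd (beta la) v).
Proof.
move=> pla hv; have := nd_bounds pla hv; rewrite /nd /= size_beta => /andP[/andP[i0 il] lv].
rewrite /in_rim !in_diag_beta //=; try lia.
by rewrite (_ : _ - _ = v) 1?(_ : _ - _ = v); lia.
Qed.

(** The node below lies on the diagonal [v - 1], which goes one row deeper exactly when [v - 1] is a
    beta number. *)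
Lemma rim_walk_below la v : is_partition la -> 0 < v <= head 0 (beta la) ->
  in_rim la ((nd (beta la) v).1.+1, (nd (beta la) v).2) = (0 < v.-1) && (v.-1 \in beta la).
Proof.
move=> pla hv; have := nd_bounds pla hv; rewrite /nd /= size_beta => /andP[/andP[i0 il] lv].
have /andP[bs b0] := beta_strict pla.
case: v hv i0 il lv => [|v] // hv i0 il lv; have cp := count_leq_pred v bs.
rewrite /in_rim !in_diag_beta //=; try lia.
case: (posnP v) => [v0|v0] /=; first by lia.
rewrite (_ : _ - _ = v) 1?(_ : _ - _ = v); try lia.
have cp1 : count (leq v) (beta la) <= size la by rewrite -size_beta count_size.
by move: cp cp1; case: (v \in beta la); lia.
Qed.

Lemma nd_pred bs v : sorted gtn bs -> all (leq 1) bs -> 0 < v ->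
  nd bs v.-1 = if (0 < v.-1) && (v.-1 \in bs) then ((nd bs v).1.+1, (nd bs v).2)
               else ((nd bs v).1, (nd bs v).2.-1).
Proof.
case: v => // v bs1 b0 _; have := count_leq_ge bs1 b0 (ltn0Sn v).
rewrite /nd /= (count_leq_pred v bs1).
case: (posnP v) => [->|v0] /=; last by case: (v \in bs) => /= h; congr pair; lia.
have -> : (0 \in bs) = false by apply/negP => /(allP b0).
by rewrite !addn0 => h; congr pair; lia.
Qed.

Lemma rim_walkE la f v : is_partition la -> v <= head 0 (beta la) -> v <= f ->
  rim_walk la f (nd (beta la) v) = [seq nd (beta la) w | w <- rev (iota 1 v)].
Proof.
move=> pla; have /andP[bs b0] := beta_strict pla.
elim: v f => [|v IH] f vh vf.
  (* [nd] at [0] falls in column [0], outside the diagram, so the walk stops after the value [1]. *)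
  case: f {vf} => //= f; rewrite /in_rim /in_diag /nd /= count_predT size_beta.
  by rewrite add0n subnn /= andbF.
case: f vf => // f vf; rewrite rev_iota1S [rim_walk _ _ _]/= in_rim_nd // rim_walk_below //=.
have := nd_pred bs b0 (ltn0Sn v); rewrite -(IH f) //; last by lia.
by rewrite [v.+1.-1]/=; case: ifP => _ ->.
Qed.

Lemma size_leq_sumn s : all (leq 1) s -> size s <= sumn s.
Proof. by elim: s => //= x s IH /andP[x0 /IH]; lia. Qed.

Lemma rim_seqE la : is_partition la ->
  rim_seq la = [seq nd (beta la) w | w <- rev (iota 1 (head 0 (beta la)))].
Proof.
case: la => [//|x s] pla; rewrite -(@rim_walkE _ (sumn (x :: s))) //; last first.
  by case/andP: pla => _ /= /andP[x0 /size_leq_sumn]; lia.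
congr rim_walk; rewrite /nd /= leqnn size_beta.
have /andP[bs _] := beta_strict pla.
have -> : count (leq (x + size s)) (beta s) = 0.
  apply/eqP; rewrite -leqn0 leqNgt -has_count; apply/hasPn => y.
  by have /allP h := path_gtn_all bs => /h /=; lia.
by congr pair; lia.
Qed.

Lemma vals_split p c s : path gtn c s -> 0 < p ->
  (all (fun x => c < x + p) s /\ vals p c s = seg p c) \/
  exists s1 x s2, [/\ s = s1 ++ x :: s2, x + p <= c, all (fun x => c < x + p) s1 &
    vals p c s = seg p c ++ vals p x s2].
Proof.
move=> cs p0; elim: s c cs => [|x s IH] c /=; first by left.
case/andP=> xc xs; case: ifP => h.
  by right; exists [::], x, s.
have /IH : path gtn c s by apply: path_gtn_leq xs; move: xc => /=; lia.
case=> [[h1 h2]|[s1 [y [s2 [h1 h2 h3 h4]]]]]; [left|right].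
  by rewrite h1 h2; split=> //; lia.
by exists (x :: s1), y, s2; rewrite h4 /= h3 -h1; split=> //; lia.
Qed.

Lemma find_eq (T : Type) (x0 : T) (P : pred T) (s : seq T) n : n < size s ->
  P (nth x0 s n) -> (forall m, m < n -> ~~ P (nth x0 s m)) -> find P s = n.
Proof.
move=> ns Pn nP; case: (ltngtP (find P s) n) => // h.
  have hs : has P s by rewrite has_find; lia.
  by have := nP _ h; rewrite nth_find.
by have := before_find x0 h; rewrite Pn.
Qed.

Lemma mem_vals_gt0 p c s v : v \in vals p c s -> 0 < v.
Proof.
elim: s c => [|x s IH] c /=; first by rewrite mem_seg; lia.
case: ifP => _; last exact: IH.
by rewrite mem_cat mem_seg => /orP[|/IH //]; lia.
Qed.

(** The value [v] sits at position [head 0 bs - v]. The last value [(c - p).+1] of a segment lies in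
    the row numbered by the count of beta numbers above [c - p], so the next row is that of the
    largest beta number at most [c - p], the next chosen element. *)
Lemma psegsE p bs b1 c s f : 0 < p -> sorted gtn bs -> all (leq 1) bs -> bs = b1 ++ c :: s ->
  c <= f ->
  psegs p [seq nd bs w | w <- rev (iota 1 (head 0 bs))] (size bs) f (head 0 bs - c)
    = [seq head 0 bs - v | v <- vals p c s].
Proof.
move=> p0 bs1 b0; elim: f b1 c s => [|f IH] b1 c s bE cf.
  by move: b0; rewrite bE all_cat => /andP[_ /andP[c0 _]]; lia.
set b := head 0 bs; set r := map _ _.
have cb : c <= b.
  rewrite /b bE; case: b1 bE => //= y b1 bE; move: bs1; rewrite bE => /path_gtn_all/allP/(_ c).
  by rewrite mem_cat mem_head orbT => /(_ isT) /=; lia.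
have c0 : 0 < c by move: b0; rewrite bE all_cat => /andP[_ /andP[]].
have sr : size r = b by rewrite size_map size_rev size_iota.
have nr v : 0 < v <= b -> nth (0, 0) r (b - v) = nd bs v.
  move=> hv; rewrite (nth_map 0) ?size_rev ?size_iota; last by lia.
  rewrite nth_rev ?size_iota; last by lia.
  by rewrite nth_iota; [congr nd|]; lia.
have segE : iota (b - c) (minn p (size r - (b - c))) = [seq b - v | v <- seg p c].
  rewrite sr /seg; apply: (@eq_from_nth _ 0); rewrite ?size_map ?size_rev ?size_iota; first by lia.
  move=> k hk; rewrite (nth_map 0) ?size_rev ?size_iota; last by lia.
  by rewrite nth_rev ?size_iota ?nth_iota; lia.
have lastE : last (b - c) (iota (b - c) (minn p (size r - (b - c)))) = b - (c - p).+1.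
  by rewrite -nth_last size_iota nth_iota sr; lia.
have -> : psegs p r (size bs) f.+1 (b - c) =
   let sg := iota (b - c) (minn p (size r - (b - c))) in
   let i := (nth (0, 0) r (last (b - c) sg)).1 in
   if size bs <= i then sg
   else sg ++ psegs p r (size bs) f (find (fun y : node => y.1 == i.+1) r).
  have : iota (b - c) (minn p (size r - (b - c))) != [::].
    by rewrite -size_eq0 size_iota; lia.
  by rewrite /=; case: (iota _ _).
rewrite /= lastE nr; last by lia.
rewrite segE /=.
have := bs1; rewrite sorted_pairwise; last by move=> x y z /=; lia.
rewrite {1}bE pairwise_cat => /and3P[/allrelP b1c _ /= /andP[/allP cs _]].
have b1gt : all (leq (c - p).+1) (rcons b1 c).
  rewrite all_rcons; apply/andP; split; first by lia.
  by apply/allP => y yb; have := b1c y c yb (mem_head _ _); move=> /=; lia.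
have s0 : all (leq 1) s by move: b0; rewrite bE all_cat => /and3P[].
have cps : path gtn c s by move: bs1; rewrite bE => /cat_sorted2[_ /=].
case: (vals_split cps p0) => [[h ->]|[s1 [x [s2 [sE xc h ->]]]]].
  (* No beta number is at most [c - p], so the segment ends in the last row. *)
  rewrite ifT // {1}bE bE -cat_rcons.
  suff : all (leq (c - p).+1) (rcons b1 c ++ s) by rewrite all_count => /eqP ->.
  rewrite all_cat b1gt; apply/allP => y ys.
  by have := allP h _ ys; have := allP s0 _ ys; rewrite /=; lia.
have bE' : bs = (b1 ++ c :: s1) ++ x :: s2 by rewrite -catA /= -sE.
have gtx : all (leq (c - p).+1) (b1 ++ c :: s1).
  rewrite -cat_rcons all_cat b1gt; apply/allP => y ys; have := allP h _ ys.
  by have := allP s0 y; rewrite sE mem_cat ys /=; lia.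
have := bs1; rewrite sorted_pairwise; last by move=> ? ? ? /=; lia.
rewrite {1}bE' pairwise_cat => /and3P[/allrelP b1x _ /= /andP[/allP xs2 _]].
have cnt0 v : x < v -> count (leq v) (x :: s2) = 0.
  move=> xv; apply/eqP; rewrite -leqn0 leqNgt -has_count; apply/hasPn => y.
  by rewrite inE => /orP[/eqP->|/xs2 /=]; lia.
have cntk : count (leq (c - p).+1) bs = size (b1 ++ c :: s1).
  rewrite {1}bE' count_cat cnt0; last by lia.
  by move: gtx; rewrite all_count => /eqP ->; rewrite addn0.
have x0 : 0 < x by move: b0; rewrite bE' all_cat => /andP[_ /andP[]].
rewrite cntk ifF; last by rewrite bE' !size_cat /=; lia.
(* The first rim node of the next row has value [x]; larger values lie in earlier rows. *)
rewrite (@find_eq _ (0, 0) _ _ (b - x)).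
- by rewrite map_cat (IH _ _ _ bE') //; lia.
- by rewrite sr; lia.
- rewrite nr ?/nd /=; last by lia.
  rewrite {1}bE' count_cat /= leqnn.
  have -> : count (leq x) (b1 ++ c :: s1) = size (b1 ++ c :: s1).
    by apply/eqP; rewrite -all_count; apply: sub_all gtx => y /=; lia.
  have -> : count (leq x) s2 = 0.
    apply/eqP; rewrite -leqn0 leqNgt -has_count; apply/hasPn => y /xs2 /=; lia.
  by rewrite addn0 addn1.
- move=> m mx; rewrite (_ : m = b - (b - m)); last by lia.
  rewrite nr ?/nd /=; last by lia.
  rewrite {1}bE' count_cat cnt0; last by lia.
  by have := count_size (leq (b - m)) (b1 ++ c :: s1); lia.
Qed.

Lemma primE p la c s : 0 < p -> is_partition la -> beta la = c :: s ->
  prim p la = [seq nd (beta la) v | v <- vals p c s].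
Proof.
move=> p0 pla E; have /andP[bs b0] := beta_strict pla.
rewrite /prim rim_seqE // size_map size_rev size_iota -size_beta.
have hE : head 0 (beta la) = c by rewrite E.
have := @psegsE p _ [::] c s c p0 bs b0 E (leqnn c).
rewrite hE subnn => ->; rewrite -map_comp; apply/eq_in_map => v hv /=.
have cps : path gtn c s by move: bs; rewrite E.
have vc := mem_vals_leq cps hv; have v0 := mem_vals_gt0 hv.
rewrite (nth_map 0) ?size_rev ?size_iota; last by lia.
rewrite nth_rev ?size_iota; last by lia.
by rewrite nth_iota; [congr nd|]; lia.
Qed.

(** * Mullineux symbols *)

(* The [z] lowest values of the image are the rows that became empty. *)
Lemma strict_split l : sorted gtn l -> exists z bs,
  [/\ l = map (addn z) bs ++ rev (iota 0 z), sorted gtn bs & all (leq 1) bs].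
Proof.
elim: l => [|y l IH] yl; first by exists 0, [::].
have /path_gtn_all/allP yl' := yl.
have [z [bs [lE bs1 b0]]] := IH (path_sorted yl).
have zy : z <= y.
  by case: z lE => // z lE; have := yl' z; rewrite lE mem_cat mem_rev mem_iota => /=; lia.
case: (eqVneq y z) => [yz|yz].
  exists z.+1, [::]; split=> //; rewrite rev_iotaS yz lE.
  case: bs lE {bs1} b0 => //= b bs lE b0; have := yl' (z + b); rewrite lE mem_head => /(_ isT) /=; lia.
exists z, (y - z :: bs); split.
- by rewrite lE /= subnKC.
- rewrite /= path_min_sorted //; apply/allP => b bb /=.
  by have := yl' (z + b); rewrite lE mem_cat map_f //= => /(_ isT) /=; lia.
- by rewrite /= b0; lia.
Qed.

Lemma count_leq_rev_iota v z : count (leq v) (rev (iota 0 z)) = z - v.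
Proof.
rewrite count_rev; elim: z => // z IH; rewrite -addn1 iotaD count_cat IH /= add0n; lia.
Qed.

Lemma mem_prim p la c s i j : 1 < p -> is_partition la -> beta la = c :: s -> 0 < j ->
  0 < i <= size la -> ((i, j) \in prim p la) =
  (i == count (leq (j + size la - i)) (beta la)) && (j + size la - i \in vals p c s).
Proof.
move=> p1 pla E j0 il; rewrite (primE (ltnW p1) pla E).
have /andP[bs b0] := beta_strict pla.
apply/mapP/andP => [[v hv]|[/eqP iE hv]].
  rewrite /nd size_beta => -[iE jE].
  by rewrite (_ : _ - _ = v) -?iE ?eqxx; [|have := count_leq_ge bs b0 (mem_vals_gt0 hv); rewrite size_beta; lia].
by exists (j + size la - i) => //; rewrite /nd -iE size_beta; congr pair; lia.
Qed.

(** On each diagonal met by the p-rim only the lowest node goes, which lowers by one the count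
    deciding membership, as in [count_shift]. *)
Lemma in_diag_removed p la c s i j : 1 < p -> is_partition la -> beta la = c :: s ->
  0 < i -> 0 < j ->
  in_diag la (i, j) && ((i, j) \notin prim p la) =
  (i <= size la) && (i <= count (leq (j + size la - i)) (shift p c s)).
Proof.
move=> p1 pla E i0 j0; rewrite in_diag_beta //.
case: (leqP i (size la)) => //= il; rewrite (mem_prim p1 pla E) ?i0 //.
have /andP[bs b0] := beta_strict pla; rewrite E in bs *.
have v0 : 0 < j + size la - i by lia.
by rewrite (count_shift p v0 bs); case: (_ \in vals _ _ _); lia.
Qed.

(** Adding [z] empty rows raises the beta numbers by [z] and appends [z - 1, ..., 0], without
    changing the diagram. *)
Lemma in_diag_strip (la bs : seq nat) z i j : sorted gtn bs -> all (leq 1) bs -> size la = size bs + z ->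
  0 < i -> 0 < j ->
  in_diag (unbeta bs) (i, j) = (i <= size la) &&
    (i <= count (leq (j + size la - i)) (map (addn z) bs ++ rev (iota 0 z))).
Proof.
move=> bs1 b0 sz i0 j0; rewrite in_diag_beta ?unbeta_partition // unbetaK // size_unbeta.
rewrite count_cat count_leq_rev_iota count_map sz.
case: (leqP i (size bs)) => h /=.
  have -> : i <= size bs + z by lia.
  have -> : z - (j + (size bs + z) - i) = 0 by lia.
  rewrite addn0.
  by congr (_ <= _); apply: eq_count => b /=; lia.
set n := count _ _; have : n <= size bs by apply: count_size.
by lia.
Qed.

Lemma vals_uniq p c s : path gtn c s -> uniq (vals p c s).
Proof.
elim: s c => [|x s IH] c /=; first by rewrite rev_uniq iota_uniq.
case/andP=> xc xs; case: ifP => h; last by apply: IH; apply: path_gtn_leq xs; move: xc => /=; lia.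
rewrite cat_uniq rev_uniq iota_uniq IH // andbT /=.
by apply/hasPn => v /(mem_vals_leq xs); rewrite mem_seg; lia.
Qed.

Lemma prim_uniq p la : 1 < p -> is_partition la -> uniq (prim p la) /\ {subset prim p la <= in_diag la}.
Proof.
move=> p1 pla; have /andP[bs b0] := beta_strict pla.
case E: (beta la) => [|c s].
  by move/(congr1 unbeta): E; rewrite betaK /= => ->.
have cs : path gtn c s by move: bs; rewrite E.
rewrite (primE (ltnW p1) pla E); split.
  rewrite map_inj_in_uniq ?vals_uniq // => v w hv hw [h1 h2].
  have := count_leq_ge bs b0 (mem_vals_gt0 hv).
  by have := count_leq_ge bs b0 (mem_vals_gt0 hw); lia.
move=> x /mapP[v hv ->]; suff /andP[] : in_rim la (nd (beta la) v) by [].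
apply: in_rim_nd => //; rewrite (mem_vals_gt0 hv) E; exact: mem_vals_leq hv.
Qed.

Lemma mull_removal p la c s z bs : 1 < p -> is_partition la -> beta la = c :: s ->
  sorted gtn bs -> all (leq 1) bs -> shift p c s = map (addn z) bs ++ rev (iota 0 z) ->
  [/\ remove_nodes la (prim p la) = unbeta bs, size (undup (prim p la)) = cost p c s,
      sumn la = cost p c s + sumn (unbeta bs) & size la = size bs + z].
Proof.
move=> p1 pla E bs1 b0 sh; have pnu := unbeta_partition bs1 b0.
have sz : size la = size bs + z.
  have := size_shift p c s; rewrite sh size_cat size_map size_rev size_iota => ->.
  by rewrite -size_beta E.
have dE i j : 0 < i -> 0 < j ->
    in_diag (unbeta bs) (i, j) = in_diag la (i, j) && ((i, j) \notin prim p la).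
  by move=> i0 j0; rewrite (in_diag_removed p1 pla E) // (@in_diag_strip la _ z) // sh.
have [uq sub] := prim_uniq p1 pla.
have sizeE : size (prim p la) = cost p c s.
  by rewrite (primE (ltnW p1) pla E) size_map size_vals.
split=> //; first exact: remove_nodesE.
  by rewrite undup_id.
by rewrite (sumn_remove pla pnu dE uq sub) sizeE.
Qed.

Lemma beta_nil la : beta la = [::] -> la = [::].
Proof. by move/(congr1 unbeta); rewrite betaK. Qed.

Lemma prim_removal p la c s : 1 < p -> is_partition la -> beta la = c :: s ->
  exists z bs, [/\ shift p c s = map (addn z) bs ++ rev (iota 0 z),
    sorted gtn bs, all (leq 1) bs,
    [/\ remove_nodes la (prim p la) = unbeta bs, size (undup (prim p la)) = cost p c s,
      sumn la = cost p c s + sumn (unbeta bs) & size la = size bs + z] &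
    [/\ 0 < c, all (leq 1) s, path gtn c s & 0 < cost p c s]].
Proof.
move=> p1 pla E; have /andP[bs b0] := beta_strict pla; rewrite E /= in bs b0.
have /andP[c0 s0] := b0; have p0 := ltnW p1.
have cpc : c - p < c by lia.
have /path_sorted/strict_split[z [cs [sh cs1 cs0]]] := path_shift p0 s0 cpc bs.
exists z, cs; split=> //; first exact: mull_removal.
by split=> //; apply: cost_gt0.
Qed.

Lemma msym_aux_fuel p f g la : 1 < p -> is_partition la -> sumn la <= f -> sumn la <= g ->
  msym_aux p f la = msym_aux p g la.
Proof.
move=> p1; elim: f g la => [|f IH] g la pla.
  by case: la pla => [|x s]; [case: g|move=> /andP[_ /=]; lia].
case: g => [|g]; first by case: la pla => [|x s] // /andP[_ /=]; lia.
case E: (beta la) => [|c s]; first by rewrite (beta_nil E).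
have [z [bs [_ bs1 b0 [h1 h2 h3 h4] [_ _ _ h5]]]] := prim_removal p1 pla E.
move=> laf lag; case: la pla E h1 h2 h3 h4 laf lag => // x la pla E h1 h2 h3 h4 laf lag.
rewrite [LHS]/= [RHS]/= h1; congr cons; apply: IH; first exact: unbeta_partition.
- by move: laf; rewrite h3; lia.
- by move: lag; rewrite h3; lia.
Qed.

Lemma mull_symbolE p la c s : 1 < p -> is_partition la -> beta la = c :: s ->
  exists z bs, [/\ shift p c s = map (addn z) bs ++ rev (iota 0 z),
    sorted gtn bs, all (leq 1) bs,
    [/\ mull_symbol p la = (cost p c s, size la) :: mull_symbol p (unbeta bs),
      sumn la = cost p c s + sumn (unbeta bs) & size la = size bs + z] &
    [/\ 0 < c, all (leq 1) s, path gtn c s & 0 < cost p c s]].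
Proof.
move=> p1 pla E; have [z [bs [e1 e2 e3 [h1 h2 h3 h4] e5]]] := prim_removal p1 pla E.
exists z, bs; split=> //; split=> //.
have c0 : 0 < cost p c s by case: e5.
rewrite /mull_symbol h3; case: (cost p c s) c0 h2 => // a _ h2.
case: la pla E h1 h2 h3 h4 => // x la pla E h1 h2 h3 h4.
rewrite addSn [LHS]/= h1 h2; congr cons; apply: msym_aux_fuel => //; last by lia.
exact: unbeta_partition.
Qed.

Definition cost_of (p : nat) (bs : seq nat) : nat := if bs is c :: s then cost p c s else 0.

Lemma head_mull_symbol p la : 1 < p -> is_partition la ->
  head (0, 0) (mull_symbol p la) = (cost_of p (beta la), size la).
Proof.
move=> p1 pla; case E: (beta la) => [|c s]; first by rewrite (beta_nil E).
by have [z [bs [_ _ _ [-> _ _] _]]] := mull_symbolE p1 pla E.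
Qed.

(** * Regularity and the inequalities between columns *)

Lemma count_leqS k s : count (leq k) s = count (leq k.+1) s + count_mem k s.
Proof. by elim: s => //= x s ->; lia. Qed.

Lemma p_regularP p la : 0 < p -> is_partition la ->
  reflect (forall x, ~ window p x (beta la)) (p_regular p la).
Proof.
move=> p0 pla; rewrite /p_regular pla; have /andP[bs b0] := beta_strict pla.
have sla : sorted geq la by case/andP: pla.
have pos k : k < size la -> 0 < nth 0 la k by rewrite partition_nth_gt0.
apply: (iffP allP) => /= [h x w | h k _].
  (* Each value of the run adds one to the count, so the run occupies [p] successive rows, whose
     first and last parts agree. *)
  have cw d : d <= p -> count (leq (x + p - d)) (beta la) = count (leq (x + p)) (beta la) + d.
    elim: d => [|d IH] dp; first by rewrite subn0 addn0.
    rewrite (count_leq_pred _ bs) (w (x + p - d.+1)); last by lia.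
    by rewrite (_ : (_ - d.+1).+1 = x + p - d) ?IH; lia.
  set i := count (leq (x + p)) (beta la) in cw.
  have x0 : 0 < x by have /(allP b0) := w x ltac:(lia).
  have iN d : d < p -> i + d < size la /\ nth 0 (beta la) (i + d) = x + p - d.+1.
    move=> dp; have := cw d.+1 dp; have := cw d (ltnW dp).
    have := count_size (leq (x + p - d.+1)) (beta la); rewrite size_beta.
    have := @count_leq_nth _ (x + p - d.+1) (i + d).+1 (gtn_sorted_geq bs) ltac:(lia) isT.
    by have := @count_leq_nth _ (x + p - d) (i + d).+1 (gtn_sorted_geq bs) ltac:(lia) isT; rewrite /=; lia.
  have [l0 n0] := iN 0 p0; have [l1 n1] := iN p.-1 ltac:(lia).
  rewrite addn0 in l0 n0; rewrite !nth_beta // in n0 n1.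
  set k := nth 0 la i in n0; have k0 := pos _ l0.
  have ki : nth 0 la (i + p.-1) = k by lia.
  have := h k (mem_nth 0 l0); rewrite -/k.
  have := @count_leq_nth la k (i + p.-1).+1 sla k0 isT.
  have := @count_leq_nth la k.+1 i.+1 sla isT isT.
  by have := count_leqS k la; rewrite /= ki -/k; lia.
rewrite ltnNge; apply/negP => pk; have := count_leqS k la.
set i := count (leq k.+1) la => ci.
have ip : i + p <= size la by apply: leq_trans (count_size (leq k) la); rewrite ci leq_add2l.
have k0 : 0 < k.
  rewrite lt0n; apply/eqP => k0; move: pk; rewrite leqNgt => /negP; apply.
  suff -> : count_mem k la = 0 by [].
  by apply/count_memPn; rewrite k0; apply/negP; case/andP: pla => _ /allP la0 /la0.
have ni d : d < p -> nth 0 la (i + d) = k.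
  move=> dp.
  have := @count_leq_nth la k (i + d).+1 sla k0 isT.
  by have := @count_leq_nth la k.+1 (i + d).+1 sla isT isT; rewrite /= -/i ci ltn_add2l (leq_trans dp pk); lia.
apply: (h (k + size la - i - p)) => y yk.
have [d dp yE] : exists2 d, d < p & y = k + (size la - (i + d).+1).
  by exists (k + size la - i.+1 - y); lia.
rewrite yE -{1}(ni d dp) -nth_beta; last by lia.
by apply: mem_nth; rewrite size_beta; lia.
Qed.

(* The column [x] may precede the column [y]; past the last column, [y = (0, 0)]. *)
Definition mstep (p : nat) (x y : nat * nat) : bool :=
  [&& 0 < x.1, y.2 + ~~ (p %| x.1) <= x.2 < y.2 + p + ~~ (p %| x.1) &
      y.1 + ~~ (p %| y.1) + (x.2 - y.2) <= x.1 < y.1 + ~~ (p %| y.1) + (x.2 - y.2) + p].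

Fixpoint msymbol (p : nat) (X : seq (nat * nat)) : bool :=
  if X is x :: X' then mstep p x (head (0, 0) X') && msymbol p X' else true.

Lemma range_step p z c s bs : 1 < p -> 0 < c -> all (leq 1) s -> path gtn c s ->
    sorted gtn bs -> all (leq 1) bs -> shift p c s = map (addn z) bs ++ rev (iota 0 z) ->
  cost_of p bs + ~~ (p %| cost_of p bs) + z <= cost p c s
    < cost_of p bs + ~~ (p %| cost_of p bs) + z + p.
Proof.
move=> p1 c0 s0 cs bs1 b0 sh; have p0 := ltnW p1.
(* A [c'] above both lists adds exactly [p] to the image side, even when [bs] is empty; the term
   [p * (c <= c')] cancels it. *)
pose c' := c + z + p + head 0 bs.
have zl : all (leq z.+1) (map (addn z) bs).
  by rewrite all_map; apply: sub_all b0 => x /=; lia.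
have zc' : z < c' by rewrite /c'; lia.
have cc' : c <= c' + p by rewrite /c'; lia.
have := range_above p0 c0 s0 cs zc' cc' sh zl.
have -> : c <= c' by rewrite /c'; lia.
have -> : [seq y - z | y <- map (addn z) bs] = bs.
  by rewrite -map_comp -[RHS]map_id; apply: eq_map => x /=; lia.
have -> : pcost p (c' - z) bs = p + (cost_of p bs + ~~ (p %| cost_of p bs)).
  rewrite /c'; case: bs b0 {bs1 sh zl zc' cc' c'} => [|b bs] /= b0.
    by rewrite dvdn0; lia.
  case/andP: b0 => b0 bs0; rewrite ifT; last by lia.
  by rewrite pcost1.
by lia.
Qed.

Lemma mem_shift_strip z bs y : (y \in map (addn z) bs ++ rev (iota 0 z)) =
  if y < z then true else y - z \in bs.
Proof.
rewrite mem_cat mem_rev mem_iota /= add0n; case: ltnP => h; first by rewrite orbT.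
rewrite orbF; apply/mapP/idP => [[x xb ->]|xb]; first by rewrite addKn.
by exists (y - z) => //; lia.
Qed.

(** [z] is recovered as the least value missing from the list. *)
Lemma strip_inj z z' bs bs' : all (leq 1) bs -> all (leq 1) bs' ->
  map (addn z) bs ++ rev (iota 0 z) = map (addn z') bs' ++ rev (iota 0 z') -> z = z' /\ bs = bs'.
Proof.
move=> b0 b0' e.
have h y : (if y < z then true else y - z \in bs) = (if y < z' then true else y - z' \in bs').
  by rewrite -!mem_shift_strip e.
have zz : z = z'.
  case: (ltngtP z z') => // hz.
    by have := h z; rewrite ltnn hz subnn => /(allP b0).
  by have := h z'; rewrite ltnn hz subnn => /esym/(allP b0').
split=> //; move: e; rewrite -zz => /(congr1 rev); rewrite !rev_cat => /(congr1 (drop (size (rev (rev (iota 0 z)))))).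
by rewrite !drop_size_cat // => /(can_inj revK) /inj_map -> // x y /addnI.
Qed.

(** If [p] does not divide the cost, [0] is in the image, so [z > 0]. More than [p] bottom values
    contain the run from [1] to [p]; exactly [p] of them, with [p] dividing the cost, fall under
    [window0_unshift]. *)
Lemma regular_down p z c s bs : 1 < p -> 0 < c -> all (leq 1) s -> path gtn c s ->
    all (leq 1) bs -> shift p c s = map (addn z) bs ++ rev (iota 0 z) ->
    (forall x, ~ window p x (c :: s)) ->
  (forall x, ~ window p x bs) /\
  ~~ (p %| cost p c s) <= z < p + ~~ (p %| cost p c s).
Proof.
move=> p1 c0 s0 cs b0 sh reg; have p0 := ltnW p1; split=> [x w|].
  have x0 : 0 < x by have /(allP b0) := w x ltac:(lia).
  have : window p (x + z) (shift p c s).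
    move=> y yx; rewrite sh mem_shift_strip ifF; last by lia.
    by apply: w; lia.
  by case/(window_unshift p1 c0 s0 cs); [lia | apply: reg | apply: reg].
apply/andP; split.
  case: (boolP (p %| _)) => //= /last_shift e.
  have : 0 \in shift p c s.
    by rewrite -e; case: (shift p c s) (size_shift p c s) => // y l _; apply: mem_last.
  by rewrite sh mem_shift_strip; case: ifP => // _ /(allP b0); rewrite sub0n.
rewrite ltnNge; apply/negP => zp.
case: (ltnP p z) => pz.
  have : window p 1 (shift p c s) by move=> y yx; rewrite sh mem_shift_strip ifT //; lia.
  by case/(window_unshift p1 c0 s0 cs); [lia | apply: reg | apply: reg].
have pd : p %| cost p c s by move: zp; case: (p %| _) => //=; lia.
apply: (reg 1); apply: window0_unshift => // y yx.
by rewrite sh mem_shift_strip ifT //; lia.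
Qed.

Lemma regular_up p z c s bs : 1 < p -> 0 < c -> all (leq 1) s -> path gtn c s ->
    all (leq 1) bs -> shift p c s = map (addn z) bs ++ rev (iota 0 z) ->
    (forall x, ~ window p x bs) -> z < p + ~~ (p %| cost p c s) ->
  forall x, ~ window p x (c :: s).
Proof.
move=> p1 c0 s0 cs b0 sh reg zp x w; have p0 := ltnW p1.
have x0 : 0 < x.
  by have := w x ltac:(lia); rewrite inE => /orP[/eqP->//|/(allP s0)].
(* Runs of the image lie in the bottom block: [z] is missing, and above it there is only a raised
   copy of [bs]. *)
have bad y : window p y (shift p c s) -> y + p <= z.
  rewrite sh => wy; case: (ltngtP y z) => yz.
  - case: (leqP (y + p) z) => // h; have := wy z ltac:(lia).
    by rewrite mem_shift_strip ltnn subnn => /(allP b0).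
  - case: (reg (y - z)) => t ty; have := wy (t + z) ltac:(lia).
    by rewrite mem_shift_strip ifF ?addnK //; lia.
  - by have := wy y ltac:(lia); rewrite mem_shift_strip yz ltnn subnn => /(allP b0).
case: (window_shift p1 c0 s0 cs x0 w) => [/bad|[/bad h xd]].
  by case: (p %| _) zp => /=; lia.
(* What remains is [z = p] and [x = 1] with [p] not dividing the cost, against the last clause of
   [window_shift]. *)
have pN : ~~ (p %| cost p c s) by case: (p %| _) zp => //=; lia.
have xE : x = 1 by move: zp; rewrite pN; lia.
by move: pN; rewrite xd.
Qed.

Lemma res_bounds p a : 0 < p -> 0 < res p a <= p.
Proof. by move=> p0; rewrite /res ltn_mod. Qed.

Lemma res_eq_dvdn p a : 0 < p -> 0 < a -> (res p a == p) = (p %| a).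
Proof.
case: p => // p _; case: a => // a _; rewrite /res /= eqSS.
rewrite [in RHS](divn_eq a p.+1) -addnS dvdn_addr ?dvdn_mull //.
have := ltn_pmod a (ltn0Sn p); rewrite ltnS => h.
case: eqP => [->|ne]; first by rewrite dvdnn.
by rewrite gtnNdvd //; lia.
Qed.

Lemma res_inj p m a b : 0 < a -> 0 < b -> m <= a < m + p -> m <= b < m + p ->
  res p a = res p b -> a = b.
Proof.
case: a => // a; case: b => // b _ _ ma mb [] /= e.
suff : a = b by move->.
wlog ab : a b ma mb e / a <= b.
  by move=> W; case: (leqP a b) => h; [|symmetry]; apply: W => //; lia.
move/eqP: e; rewrite eq_sym eqn_mod_dvd // => h.
case: (posnP (b - a)) => [|h0]; first by lia.
by have := dvdn_leq h0 h; lia.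
Qed.

Lemma mull_step_down p la c s z bs : 1 < p -> beta la = c :: s -> p_regular p la ->
    shift p c s = map (addn z) bs ++ rev (iota 0 z) -> sorted gtn bs -> all (leq 1) bs ->
    size la = size bs + z ->
  p_regular p (unbeta bs) && mstep p (cost p c s, size la) (cost_of p bs, size bs).
Proof.
move=> p1 E rla sh bs1 b0 sz; have p0 := ltnW p1.
have pla : is_partition la by case/andP: rla.
move: rla => /(p_regularP p0 pla); rewrite E => reg.
have /andP[] := beta_strict pla; rewrite E => /= cs /andP[c0 s0].
have [reg' zb] := regular_down p1 c0 s0 cs b0 sh reg.
have pnu := unbeta_partition bs1 b0.
apply/andP; split; first by apply/(p_regularP p0 pnu); rewrite unbetaK.
have := range_step p1 c0 s0 cs bs1 b0 sh.
rewrite /mstep /= sz cost_gt0 // addKn; move: zb; case: (p %| cost p c s) => /=; lia.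
Qed.

Lemma mull_symbol_ind p (P : seq nat -> Prop) : 1 < p -> P [::] ->
  (forall la c s z bs, beta la = c :: s -> p_regular p la ->
    shift p c s = map (addn z) bs ++ rev (iota 0 z) -> sorted gtn bs -> all (leq 1) bs ->
    size la = size bs + z -> sumn la = cost p c s + sumn (unbeta bs) ->
    p_regular p (unbeta bs) ->
    mstep p (cost p c s, size la) (cost_of p bs, size bs) ->
    mull_symbol p la = (cost p c s, size la) :: mull_symbol p (unbeta bs) ->
    P (unbeta bs) -> P la) ->
  forall la, p_regular p la -> P la.
Proof.
move=> p1 P0 Pstep la; have [n] := ubnP (sumn la); elim: n la => // n IH la lan rla.
have pla : is_partition la by case/andP: rla.
case E: (beta la) => [|c s]; first by rewrite (beta_nil E).
have [z [bs [sh bs1 b0 [h1 h2 h3] [c0 s0 cs cc0]]]] := mull_symbolE p1 pla E.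
have /andP[rnu st] := mull_step_down p1 E rla sh bs1 b0 h3.
by apply: (Pstep la c s z bs) => //; apply: IH => //; lia.
Qed.

Lemma msymbol_mull p la : 1 < p -> p_regular p la -> msymbol p (mull_symbol p la).
Proof.
move=> p1; move: la; apply: (mull_symbol_ind p1) => // la c s z bs E rla sh bs1 b0 h1 h2 rnu st -> IH /=.
have pnu : is_partition (unbeta bs) by case/andP: rnu.
by rewrite IH andbT head_mull_symbol // unbetaK // size_unbeta.
Qed.

Lemma sumn_mull_symbol p la : 1 < p -> p_regular p la ->
  sumn la = sumn (unzip1 (mull_symbol p la)).
Proof.
by move=> p1; move: la; apply: (mull_symbol_ind p1) => // la c s z bs E rla sh bs1 b0 h1 h2 rnu st -> /= <-.
Qed.

(** The tail of the symbol gives [bs] and the drop in row counts gives [z], hence the image; the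
    residue of the first entry then lets [unshift] recover [c :: s]. *)
Lemma mull_symbol_inj p la mu : 1 < p -> p_regular p la -> p_regular p mu ->
  mull_symbol p la = mull_symbol p mu -> la = mu.
Proof.
move=> p1 rla; move: la rla mu.
apply: (mull_symbol_ind p1) => [|la c s z bs E rla sh bs1 b0 h1 h2 rnu st e IH] mu rmu.
  have pmu : is_partition mu by case/andP: rmu.
  case E: (beta mu) => [|c s]; first by rewrite (beta_nil E).
  by have [z [bs [_ _ _ [-> _ _] _]]] := mull_symbolE p1 pmu E.
move: mu rmu; apply: (mull_symbol_ind p1) => [|mu c' s' z' bs' E' rmu sh' bs1' b0' h1' h2' rnu' st' e' _].
  by rewrite e.
rewrite e e' => -[ec sz /(IH _ rnu') nuE].
have bE : bs = bs' by rewrite -(unbetaK bs1 b0) nuE unbetaK.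
have zE : z = z' by move: sz; rewrite h1 h1' bE; clear; lia.
have pla : is_partition la by case/andP: rla.
have pmu : is_partition mu by case/andP: rmu.
have /andP[] := beta_strict pla; rewrite E => /= cs /andP[c0 s0].
have /andP[] := beta_strict pmu; rewrite E' => /= cs' /andP[c0' s0'].
have := shiftK (ltnW p1) c0' s0' cs'; rewrite -ec sh' -bE -zE -sh shiftK //; last exact: ltnW.
by case=> cE sE; rewrite -(betaK la) -(betaK mu) E E' cE sE.
Qed.

(** [unshift] is applied with the residue of [a]. The resulting cost and [a] share this residue and
    lie in the same interval of length [p], so they are equal. *)
Lemma mull_step_up p nu a r : 1 < p -> p_regular p nu ->
    mstep p (a, r) (cost_of p (beta nu), size nu) ->
  exists2 la, p_regular p la & mull_symbol p la = (a, r) :: mull_symbol p nu.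
Proof.
move=> p1 rnu /and3P[/= a0 rr aa]; have p0 := ltnW p1.
have pnu : is_partition nu by case/andP: rnu.
have nur : size nu <= r by move: rr; clear; lia.
have /andP[bs1 b0] := beta_strict pnu; set bs := beta nu in bs1 b0 aa.
pose z := r - size nu; pose l := map (addn z) bs ++ rev (iota 0 z).
have zN : ~~ (p %| a) -> 0 < z by move=> h; move: rr; rewrite h /z; lia.
(* An empty list would give [0 < a < p], so [p] would not divide [a], forcing [z > 0]. *)
have lN : l != [::].
  rewrite -size_eq0 size_cat size_map size_rev size_iota addn_eq0 negb_and orbC.
  case: (posnP z) => //= z0; apply/negP; rewrite size_eq0 => /eqP bsN.
  move: aa; rewrite -/z z0 bsN /= dvdn0 /= => aa.
  by move: (zN); rewrite z0 gtnNdvd; lia.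
have ls : sorted gtn l.
  rewrite sorted_pairwise; last by move=> ? ? ? /=; lia.
  rewrite pairwise_cat -!sorted_pairwise; try by move=> ? ? ? /=; lia.
  rewrite rev_sorted (_ : sorted _ (iota 0 z)); last exact: iota_ltn_sorted.
  rewrite sorted_map andbT; apply/andP; split.
    apply/allrelP => x y /mapP[t tb ->]; rewrite mem_rev mem_iota => h.
    by have := allP b0 _ tb => /=; lia.
  by apply: sub_sorted bs1 => x y /=; lia.
have lastl : 0 < z -> last 0 l = 0.
  move=> z0; rewrite last_cat -(prednK z0) [iota _ _]/= rev_cons last_rcons //.
have tb := res_bounds a p0.
have tl : res p a < p -> last 0 l = 0.
  by move=> h; apply/lastl/zN; rewrite -res_eq_dvdn //; lia.
case E: (unshift p (res p a) l) => [c s].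
have Q1 y : 0 < y -> y \in l -> (0 < y) && (0 < y + p) by lia.
have [sh cs rc /= /andP[c0 s0]] := unshiftP (Q := leq 1) p0 tb lN ls tl Q1 ltac:(rewrite /=; lia) E.
have rg := range_step p1 c0 s0 cs bs1 b0 sh.
have ca : cost p c s = a.
  apply: (res_inj _ a0 rg _ rc); first exact: cost_gt0.
  by move: aa; rewrite -/z; clear; lia.
have reg : forall x, ~ window p x bs by apply/(p_regularP p0 pnu).
have regB := regular_up p1 c0 s0 cs b0 sh reg.
have cs1 : sorted gtn (c :: s) by [].
have cs0 : all (leq 1) (c :: s) by rewrite /= c0.
have pla := unbeta_partition cs1 cs0.
exists (unbeta (c :: s)).
  apply/(p_regularP p0 pla); rewrite unbetaK //; apply: regB.
  by rewrite ca /z; move: rr; clear; case: (p %| a) => /=; lia.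
have [z' [bs' [sh' bs1' b0' [-> _ sz'] _]]] := mull_symbolE p1 pla (unbetaK cs1 cs0).
have szr : size (unbeta (c :: s)) = r.
  rewrite size_unbeta /= -(size_shift p c) sh size_cat size_map size_rev size_iota /bs size_beta.
  by rewrite addnC subnK.
rewrite ca szr.
have [_ ->] := strip_inj b0' b0 (etrans (esym sh') sh).
by rewrite betaK.
Qed.

Lemma msymbol_exists p X : 1 < p -> msymbol p X ->
  exists2 la, p_regular p la & mull_symbol p la = X.
Proof.
move=> p1; elim: X => [|[a r] X IH] /=; first by exists [::].
case/andP=> st /IH[nu rnu nuE]; have pnu : is_partition nu by case/andP: rnu.
have [|la rla laE] := @mull_step_up p nu a r p1 rnu.
  by rewrite -head_mull_symbol // nuE.
by exists la => //; rewrite laE nuE.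
Qed.

(** * BG-symbols *)

Fixpoint arms (k : nat) (la : seq nat) : seq nat :=
  if la is x :: s then x - k :: arms k.+1 s else [::].

(* The numbers [la_i - i + 1] for [i <= k(la)]: Frobenius arm lengths plus one. *)
Definition frob (la : seq nat) : seq nat := [seq e <- arms 0 la | 0 < e].

(** Wraps the partition of [es'] in a symmetric hook: a first row and a first column of length [e],
    after padding with empty rows. *)
Fixpoint unfrob (es : seq nat) : seq nat :=
  if es is e :: es' then
    let mu := unfrob es' in e :: map succn (mu ++ nseq (e.-1 - size mu) 0)
  else [::].

(** For [k = 0] this is [la_i - i + 1 = b_i - (l - 1)]; [k] is the number of rows already passed. *)
Lemma arms_beta k la : [seq e <- arms k la | 0 < e] =
  [seq b - (k + size la).-1 | b <- beta la & (k + size la).-1 < b].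
Proof.
elim: la k => //= x s IH k; rewrite IH addnS addSn /=.
have -> : (k + size s < x + size s) = (0 < x - k) by lia.
by case: ifP => //= _; congr (_ :: _); lia.
Qed.

Lemma frob_beta la : frob la = [seq b - (size la).-1 | b <- beta la & (size la).-1 < b].
Proof. exact: arms_beta. Qed.

Lemma frob_strict la : is_partition la -> sorted gtn (frob la) && all (leq 1) (frob la).
Proof.
move=> /beta_strict /andP[bs _]; apply/andP; split; last exact: filter_all.
rewrite frob_beta sorted_map; set f := filter _ _.
have : sorted gtn f by apply: sorted_filter bs => x y z /=; lia.
have : all (leq (size la)) f.
  by rewrite all_filter; apply/allP => b _; apply/implyP; lia.
elim: f => // b [|b' f] IH //= /and3P[h h' hf] /andP[bb bf].
by move: IH => /=; rewrite h' hf bf => -> //; lia.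
Qed.

Lemma count_frob la w : 0 < w ->
  count (leq w) (frob la) = count (leq (w + (size la).-1)) (beta la).
Proof.
move=> w0; rewrite frob_beta count_map count_filter; apply: eq_count => b /=; lia.
Qed.

(** On or above the main diagonal [j + l - i] is at least [l], so only beta numbers above [l - 1]
    are counted. *)
Lemma in_diag_frob la i j : is_partition la -> 0 < i <= j ->
  in_diag la (i, j) = (i <= count (leq (j - i).+1) (frob la)).
Proof.
move=> pla /andP[i0 ij]; rewrite in_diag_beta //; last by lia.
rewrite count_frob //.
case: la pla => [|x s] pla; first by rewrite /= leqn0; lia.
rewrite (_ : (j - i).+1 + (size (x :: s)).-1 = j + size (x :: s) - i); last by rewrite /=; lia.
by have := count_size (leq (j + size (x :: s) - i)) (beta (x :: s)); rewrite size_beta; lia.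
Qed.

(** * Conjugation and self-conjugate partitions *)

Lemma part_conj la j : is_partition la -> 0 < j -> part (conj_part la) j = count (leq j) la.
Proof.
move=> /andP[sla la0]; case: j => // j _; rewrite /part /conj_part /=.
case: (ltnP j (head 0 la)) => h.
  by rewrite (nth_map 0) ?size_iota // nth_iota.
rewrite nth_default ?size_map ?size_iota //; apply/esym/eqP; rewrite -leqn0 leqNgt.
by rewrite (@count_leq_nth la j.+1 1) //= nth0 -ltnNge ltnS.
Qed.

Lemma in_diag_conj la i j : is_partition la -> 0 < i -> 0 < j ->
  in_diag (conj_part la) (j, i) = in_diag la (i, j).
Proof.
move=> pla i0 j0; rewrite /in_diag /= i0 j0 /= part_conj //.
by rewrite count_leq_nth //; case/andP: pla.
Qed.

Lemma conj_partition la : is_partition la -> is_partition (conj_part la).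
Proof.
move=> pla; apply/andP; split.
  rewrite /conj_part sorted_map; apply: (@sub_sorted _ leq); last exact: iota_sorted.
  by move=> i j /= ij; apply: sub_count => x /=; lia.
rewrite /conj_part all_map; apply/allP => j; rewrite mem_iota /= => h.
rewrite -has_count; apply/hasP; exists (head 0 la); last by lia.
by case: la h {pla} => [|x s] /=; [lia|rewrite mem_head].
Qed.

Lemma self_conjP la : is_partition la ->
  reflect (forall i j, 0 < i -> 0 < j -> in_diag la (i, j) = in_diag la (j, i)) (self_conj la).
Proof.
move=> pla; apply: (iffP eqP) => [e i j i0 j0 | h].
  by rewrite -[in RHS]e in_diag_conj.
apply: partition_ext => //; first exact: conj_partition.
by move=> i j i0 j0; rewrite in_diag_conj // h.
Qed.

Lemma self_conj_ext la mu : is_partition la -> self_conj la -> is_partition mu -> self_conj mu ->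
  frob la = frob mu -> la = mu.
Proof.
move=> pla /(self_conjP pla) sla pmu /(self_conjP pmu) smu e.
have h i j : 0 < i <= j -> in_diag mu (i, j) = in_diag la (i, j).
  by move=> ij; rewrite !in_diag_frob // e.
apply: partition_ext => // i j i0 j0; case: (leqP i j) => ij; first by rewrite h ?i0.
by rewrite smu // sla // h // j0 ltnW.
Qed.

(** Induction peels off the outer hook. The size identity says that an entry [e] contributes a hook
    of [2 e - 1] nodes. *)
Lemma unfrobP es : sorted gtn es -> all (leq 1) es ->
  [/\ is_partition (unfrob es), self_conj (unfrob es), frob (unfrob es) = es,
      size (unfrob es) = head 0 es & sumn (unfrob es) + size es = 2 * sumn es].
Proof.
elim: es => // e es IH ees /andP[e0 es0].
have [pmu smu hmu zmu nmu] := IH (path_sorted ees) es0.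
set mu := unfrob es in pmu smu hmu zmu nmu.
have he : size mu < e.
  by rewrite zmu; case: (es) ees es0 => //= x s /andP[].
have muE : unfrob (e :: es) = e :: map succn (mu ++ nseq (e.-1 - size mu) 0) by [].
set t := mu ++ _ in muE.
have sz : size (unfrob (e :: es)) = e.
  by rewrite muE /= size_map size_cat size_nseq; lia.
have hd : head 0 mu <= size mu by rewrite zmu /mu; case: (es).
have pla : is_partition (unfrob (e :: es)).
  rewrite muE /is_partition /=; apply/and3P; split.
  - rewrite path_sortedE; last by move=> x y z /=; lia.
    apply/andP; split.
      rewrite all_map; apply/allP => x; rewrite mem_cat mem_nseq => /orP[xm|] /=; last by lia.
      suff : x <= head 0 mu by lia.
      case/andP: pmu; case: (mu) xm => //= y s xm ys _; move: xm; rewrite inE => /orP[/eqP->//|].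
      by have /allP h := order_path_min (rev_trans leq_trans) ys => /h.
    rewrite sorted_map; apply: (@sub_sorted _ geq); first by [].
    rewrite sorted_pairwise; last by move=> x y z /=; lia.
    rewrite pairwise_cat -!sorted_pairwise; try by move=> x y z /=; lia.
    apply/and3P; split; last 1 first.
    + by case: (e.-1 - _) => //= n; elim: n.
    + by apply/allrelP => x y _; rewrite mem_nseq => /andP[_ /eqP->].
    + by case/andP: pmu.
  - by [].
  - by rewrite all_map; apply/allP.
have tE i : nth 0 t i = nth 0 mu i.
  rewrite nth_cat nth_nseq; case: ltnP => // h; rewrite [RHS]nth_default //; by case: ifP.
split=> //; last 1 first.
- rewrite muE /= -[in RHS]/t; suff : sumn (map succn t) = sumn mu + e.-1 by lia.
  have -> : sumn (map succn t) = sumn t + size t by elim: (t) => //= x s ->; lia.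
  by rewrite sumn_cat sumn_nseq size_cat size_nseq mul0n; lia.
- apply/(self_conjP pla).
  have sym := elimT (self_conjP pmu) smu.
  have d1 k : 0 < k -> in_diag (unfrob (e :: es)) (1, k) = (k <= e).
    by move=> k0; rewrite /in_diag /part muE /= k0.
  have d2 k : 0 < k -> in_diag (unfrob (e :: es)) (k, 1) = (k <= e).
    move=> k0; rewrite /in_diag /part /= k0 /=.
    by rewrite partition_nth_gt0 // sz; lia.
  case=> [|[|i]] // [|[|j]] // _ _; rewrite ?d1 ?d2 //.
  have := sym i.+1 j.+1 isT isT; rewrite /in_diag /part muE /= -!tE.
  have ss k h : (h < nth 0 (map succn t) k) = (h <= nth 0 t k) && (k < size t).
    case: (ltnP k (size t)) => kt; first by rewrite (nth_map 0) // andbT.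
    by rewrite nth_default ?size_map // andbF.
  rewrite !ss; case: (ltnP i (size t)) => it; case: (ltnP j (size t)) => jt //=.
  + by rewrite !andbT.
  + by rewrite [nth 0 t j]nth_default // andbT andbF => ->.
  + by rewrite [nth 0 t i]nth_default // andbT andbF => <-.
  + by rewrite !andbF.
- rewrite /frob muE /= subn0 e0; congr cons; rewrite -[RHS]hmu /frob.
  have -> : forall k s, arms k.+1 (map succn s) = arms k s.
    by move=> k s; elim: s k => //= x s IHs k; rewrite IHs subSS.
  suff : forall n s k, [seq e <- arms k (s ++ nseq n 0) | 0 < e] = [seq e <- arms k s | 0 < e] by apply.
  move=> n; elim=> [|x s IHs] k /=; last by rewrite IHs.
  by elim: n k => //= n IHn k; rewrite sub0n.
Qed.

(** * Removal of the symmetrized p-rim *)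

(** Choices depend only on differences, and a segment starting at or below [z] has no value above
    [z]; truncation only shortens the segment crossing [z]. *)
Lemma mem_vals_above p z c s w : path gtn c s -> z < c -> 0 < w ->
  (w \in vals p (c - z) [seq b - z | b <- s & z < b]) = (w + z \in vals p c s).
Proof.
move=> + + w0; elim: s c => [|x s IH] c /=; first by rewrite !mem_seg; lia.
case/andP=> xc xs zc.
have cs : path gtn c s by apply: path_gtn_leq xs; move: xc => /=; lia.
case: (ltnP z x) => zx /=.
  have -> : (x - z + p <= c - z) = (x + p <= c) by lia.
  case: ifP => h; last exact: IH.
  by rewrite !mem_cat IH // !mem_seg; congr (_ || _); lia.
have -> : [seq b <- s | z < b] = [::].
  apply/eqP; rewrite -[_ == _]negbK -has_filter; apply/hasPn => y ys.
  by have /allP/(_ _ ys) := path_gtn_all xs; move=> /=; lia.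
have e : (w + z \in vals p c s) = (w \in seg p (c - z)).
  rewrite -IH // (_ : [seq b <- s | z < b] = [::]) //.
  apply/eqP; rewrite -[_ == _]negbK -has_filter; apply/hasPn => y ys.
  by have /allP/(_ _ ys) := path_gtn_all xs; move=> /=; lia.
case: ifP => h; last by rewrite e.
rewrite mem_cat !mem_seg /=; case: (boolP (w + z \in vals p x s)) => [/(mem_vals_leq xs)|_]; lia.
Qed.

Lemma beta_frob la e s : is_partition la -> frob la = e :: s ->
  exists c t, [/\ beta la = c :: t, (size la).-1 < c, e = c - (size la).-1 &
    s = [seq b - (size la).-1 | b <- t & (size la).-1 < b]].
Proof.
move=> pla; rewrite frob_beta; case E: (beta la) => [|c t] //=.
case: ifP => [h [<- <-]|h]; first by exists c, t.
have /andP[bs _] := beta_strict pla; rewrite E in bs.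
rewrite (_ : [seq b <- t | _] = [::]) //.
apply/eqP; rewrite -[_ == _]negbK -has_filter; apply/hasPn => y ys.
by have /allP/(_ _ ys) := path_gtn_all bs; move: h => /=; lia.
Qed.

Lemma mem_prim_frob p la e s i j : 1 < p -> is_partition la -> frob la = e :: s ->
  0 < i <= j -> i <= size la -> ((i, j) \in prim p la) =
  (i == count (leq (j - i).+1) (frob la)) && ((j - i).+1 \in vals p e s).
Proof.
move=> p1 pla E /andP[i0 ij] il; have [c [t [bE zc eE sE]]] := beta_frob pla E.
have /andP[bs b0] := beta_strict pla; rewrite bE in bs.
rewrite (mem_prim p1 pla bE) ?i0 //; last by lia.
rewrite count_frob // eE sE mem_vals_above //.
by have -> : (j - i).+1 + (size la).-1 = j + size la - i by lia.
Qed.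

Lemma mem_U_rim p la x : (x \in U_rim p la) = (x.1 <= x.2) && (x \in prim p la).
Proof. by rewrite mem_undup mem_filter. Qed.

Lemma mem_rim_star p la i j : ((i, j) \in rim_star p la) =
  if i <= j then (i, j) \in prim p la else (j, i) \in prim p la.
Proof.
have sw (s : seq node) : ((i, j) \in [seq (x.2, x.1) | x <- s]) = ((j, i) \in s).
  apply/mapP/idP => [[[k l] h [-> ->]]|h] //.
  by exists (j, i).
rewrite mem_undup mem_cat sw !mem_U_rim /=; case: (ltngtP i j) => //= [|->]; first by rewrite orbF.
exact: orbb.
Qed.

(** A rim node of value [v] has [i <= j] exactly when [v >= l]; lowered by [l - 1], these values are
    those of the chain of [frob la]. *)
Lemma size_U_rim p la e s : 1 < p -> is_partition la -> frob la = e :: s ->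
  size (U_rim p la) = cost p e s.
Proof.
move=> p1 pla E; have [c [t [bE zc eE sE]]] := beta_frob pla E.
have /andP[bs b0] := beta_strict pla; have ct : path gtn c t by move: bs; rewrite bE.
have /andP[/= es _] := frob_strict pla; rewrite E in es.
have [uq sub] := prim_uniq p1 pla.
have l0 : 0 < size la by rewrite -size_beta bE.
have hv w : w \in vals p e s -> w + (size la).-1 \in vals p c t.
  by move=> h; rewrite -mem_vals_above // -?eE -?sE // (mem_vals_gt0 h).
rewrite -size_vals -(size_map (fun w => nd (beta la) (w + (size la).-1))).
apply: perm_size; apply: uniq_perm; first exact: undup_uniq.
  rewrite map_inj_in_uniq ?vals_uniq // => v w /hv hv1 /hv hw1 [h1 h2].
  have := count_leq_ge bs b0 (mem_vals_gt0 hv1).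
  by have := count_leq_ge bs b0 (mem_vals_gt0 hw1); lia.
move=> x; rewrite mem_U_rim (primE (ltnW p1) pla bE); apply/andP/mapP.
  case=> + /mapP[v vv xE]; rewrite xE /nd size_beta /= => h.
  have := count_leq_ge bs b0 (mem_vals_gt0 vv); rewrite size_beta => h2.
  exists (v - (size la).-1); last by rewrite subnK //; lia.
  by rewrite eE sE mem_vals_above // ?subnK //; lia.
case=> w /[dup] ww /hv h ->; split; last exact: map_f.
have := count_leq_ge bs b0 (mem_vals_gt0 h); rewrite /nd size_beta /= => h2.
by have := mem_vals_gt0 ww; lia.
Qed.

Lemma shift_filter_strict p e s : 0 < p -> 0 < e -> all (leq 1) s -> path gtn e s ->
  sorted gtn [seq y <- shift p e s | 0 < y] /\ all (leq 1) [seq y <- shift p e s | 0 < y].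
Proof.
move=> p0 e0 s0 es; split; last exact: filter_all.
apply: sorted_filter; first by move=> ? ? ? /=; lia.
have epe : e - p < e by lia.
exact: path_sorted (path_shift p0 s0 epe es).
Qed.

(** On and above the diagonal this is again [count_shift], and counts at positive thresholds do not
    see a dropped [0]. Symmetry gives the other half. *)
Lemma star_removal p la e s : 1 < p -> is_partition la -> self_conj la -> frob la = e :: s ->
  let mu := unfrob [seq y <- shift p e s | 0 < y] in
  remove_nodes la (rim_star p la) = mu /\ sumn la = size (rim_star p la) + sumn mu.
Proof.
move=> p1 pla /(self_conjP pla) sla E mu.
have /andP[es /=] := frob_strict pla; rewrite E in es * => /andP[e0 s0].
have [f1 f2] := shift_filter_strict (ltnW p1) e0 s0 es.
have [pmu /(self_conjP _) smu hmu _ _] := unfrobP f1 f2; rewrite -/mu in pmu smu hmu.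
have {}smu := smu pmu.
have dE i j : 0 < i <= j -> in_diag mu (i, j) = in_diag la (i, j) && ((i, j) \notin prim p la).
  move=> ij; rewrite !in_diag_frob // hmu count_filter.
  rewrite (@eq_in_count _ _ (leq (j - i).+1)); last by move=> y _ /=; lia.
  have cs := @count_shift p e s (j - i).+1 isT es.
  case: (leqP i (size la)) => il.
    rewrite (mem_prim_frob p1 pla E) // E.
    rewrite cs; case: (_ \in vals _ _ _); rewrite ?addn0 ?addn1 ?andbF ?andbT //.
    by move: (count _ _) => n; clear; lia.
  have h : (i <= count (leq (j - i).+1) (e :: s)) = false.
    have /andP[i0 ij'] := ij; have j0 := leq_trans i0 ij'.
    by rewrite -E -in_diag_frob // in_diag_beta // leqNgt il.
  rewrite E h; apply: contraFF h => h.
  by rewrite cs; apply: leq_trans h (leq_addr _ _).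
have dE' i j : 0 < i -> 0 < j -> in_diag mu (i, j) = in_diag la (i, j) && ((i, j) \notin rim_star p la).
  move=> i0 j0; rewrite mem_rim_star; case: leqP => ij; first by rewrite dE ?i0.
  by rewrite smu // sla // dE // j0 ltnW.
split; first exact: remove_nodesE.
apply: sumn_remove => //; first exact: undup_uniq.
have [_ sub] := prim_uniq p1 pla.
case=> i j; rewrite mem_rim_star; case: ifP => _ /sub //.
by move=> /[dup] /in_diag_pos /andP[/= j0 i0]; rewrite -topredE /= sla.
Qed.

Definition zeros (l : seq nat) : nat := size l - size [seq y <- l | 0 < y].

Lemma sumn_filter_pos (l : seq nat) : sumn [seq y <- l | 0 < y] = sumn l.
Proof. by elim: l => //= -[|y] l IH /=; rewrite IH. Qed.

Lemma zerosE l : sorted gtn l -> (l = [seq y <- l | 0 < y] ++ nseq (zeros l) 0) /\ zeros l = (0 \in l).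
Proof.
rewrite /zeros; elim: l => // y l IH yl; have [e1 e2] := IH (path_sorted yl).
rewrite inE; case: y yl => [|y] yl /=.
  have -> : l = [::].
    by case: l yl {IH e1 e2} => //= x l /andP[].
  by [].
by rewrite subSS e2 {1}e1 e2.
Qed.

(** The greedy map lowers the sum of the arm numbers by the cost and their number by [zeros]; as
    each [e] stands for [2 e - 1] nodes, the size falls by [2 cost - zeros]. *)
Lemma star_sizes p la e s : 1 < p -> is_partition la -> self_conj la -> frob la = e :: s ->
  let l := shift p e s in let mu := unfrob [seq y <- l | 0 < y] in
  [/\ remove_nodes la (rim_star p la) = mu, size (rim_star p la) + zeros l = 2 * cost p e s,
     size (U_rim p la) = cost p e s, sumn la = size (rim_star p la) + sumn mu &
     0 < size (rim_star p la)].
Proof.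
move=> p1 pla sla E l mu; have [rE nE] := star_removal p1 pla sla E.
have /andP[es /=] := frob_strict pla; rewrite E in es * => /andP[e0 s0].
have [f1 f2] := shift_filter_strict (ltnW p1) e0 s0 es.
have [_ _ _ _ nmu] := unfrobP f1 f2.
have ps : sorted gtn (e :: s) by [].
have ps0 : all (leq 1) (e :: s) by rewrite /= e0.
have [_ _ _ _ nla] := unfrobP ps ps0.
have laE : la = unfrob (e :: s).
  by have [h1 h2 h3 _ _] := unfrobP ps ps0; apply: self_conj_ext => //; rewrite h3.
have cc := sumn_shift p e s.
have c0 := cost_gt0 (ltnW p1) e0 s0.
rewrite -laE in nla; rewrite sumn_filter_pos -/l -/mu in nmu.
have szE : size (rim_star p la) + zeros l = 2 * cost p e s.
  move: nla nmu nE cc; rewrite /zeros -/mu /= -(size_shift p e) -/l => nla nmu nE cc.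
  have : size [seq y <- l | 0 < y] <= size l by rewrite size_filter count_size.
  by rewrite -/mu in nE; lia.
split=> //; first exact: size_U_rim.
have epe : e - p < e by lia.
have [_ zE] := zerosE (path_sorted (path_shift (ltnW p1) s0 epe es)).
by move: szE; rewrite /l zE; case: (_ \in _); lia.
Qed.

Lemma frob_nil la : is_partition la -> frob la = [::] -> la = [::].
Proof. by case: la => // x s /andP[_ /= /andP[x0 _]]; rewrite /frob /= subn0 x0. Qed.

Lemma bgsym_aux_fuel p f g la : 1 < p -> is_partition la -> self_conj la ->
  sumn la <= f -> sumn la <= g -> bgsym_aux p f la = bgsym_aux p g la.
Proof.
move=> p1; elim: f g la => [|f IH] g la pla sla.
  by case: la pla sla => [|x s]; [case: g|move=> /andP[_ /=]; lia].
case: g => [|g]; first by case: la pla sla => [|x s] // /andP[_ /=]; lia.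
case E: (frob la) => [|e s]; first by rewrite (frob_nil pla E).
have [h1 _ _ h3 h4] := star_sizes p1 pla sla E.
have /andP[es /=] := frob_strict pla; rewrite E in es * => /andP[e0 s0].
have [f1 f2] := shift_filter_strict (ltnW p1) e0 s0 es.
have [pmu smu _ _ _] := unfrobP f1 f2.
move=> laf lag; case: la pla sla E h1 h3 h4 laf lag => // x la pla sla E h1 h3 h4 laf lag.
rewrite [LHS]/= [RHS]/= h1; congr cons; apply: IH => //.
- by move: laf; rewrite h3; lia.
- by move: lag; rewrite h3; lia.
Qed.

Lemma BG_symbolE p la e s : 1 < p -> is_partition la -> self_conj la -> frob la = e :: s ->
  let l := shift p e s in let mu := unfrob [seq y <- l | 0 < y] in
  exists a, [/\ BG_symbol p la = (a, cost p e s) :: BG_symbol p mu,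
     a + zeros l = 2 * cost p e s, sumn la = a + sumn mu & 0 < a].
Proof.
move=> p1 pla sla E l mu; have [h1 h2 h3 h4 h5] := star_sizes p1 pla sla E.
exists (size (rim_star p la)); split=> //.
have /andP[es /=] := frob_strict pla; rewrite E in es * => /andP[e0 s0].
have [f1 f2] := shift_filter_strict (ltnW p1) e0 s0 es.
have [pmu smu _ _ _] := unfrobP f1 f2.
have [a aE] : exists a, size (rim_star p la) = a.+1.
  by case: (size _) h5 => // a; exists a.
rewrite /BG_symbol h4 -h3 aE addSn.
case: la pla sla E h1 h2 h3 h4 aE {h5} => // x la pla sla E h1 h2 h3 h4 aE.
by rewrite [LHS]/= h1 aE; congr cons; apply: bgsym_aux_fuel => //; lia.
Qed.

(** * The hook condition and the columns of BG-symbols *)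

Definition bg_arms (p : nat) (es : seq nat) : bool := all (fun e => ~~ (p %| 2 * e - 1)) es.

Lemma nth_arms k la i : i < size la -> nth 0 (arms k la) i = nth 0 la i - (k + i).
Proof.
elim: la k i => //= x s IH k [|i] h /=; first by rewrite addn0.
by rewrite IH // addSnnS.
Qed.

Lemma size_arms k la : size (arms k la) = size la.
Proof. by elim: la k => //= x s IH k; rewrite IH. Qed.

Lemma sorted_leq_nth_geq s i j : sorted geq s -> i <= j -> nth 0 s j <= nth 0 s i.
Proof.
move=> ss ij; case: (ltnP j (size s)) => h; last by rewrite nth_default.
apply: (sorted_leq_nth (rev_trans leq_trans) leqnn 0 ss) => //; rewrite inE //.
exact: leq_ltn_trans h.
Qed.

Lemma leq_kdiag la i : is_partition la -> 0 < i -> (i <= kdiag la) = (i <= part la i).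
Proof.
move=> pla i0; apply/idP/idP => [ik|ip].
  have : kdiag la = 0 \/ kdiag la \in [seq i <- iota 1 (size la) | i <= part la i].
    rewrite /kdiag; elim: [seq _ <- _ | _] => [|x s IH] /=; first by left.
    right; case: IH => [->|IH]; first by rewrite maxn0 mem_head.
    rewrite inE; case: (leqP (foldr maxn 0 s) x) => h.
      by rewrite eqxx.
    by rewrite IH orbT.
  case=> [k0|]; first by move: ik; rewrite k0; lia.
  rewrite mem_filter => /andP[h _]; apply: (leq_trans ik (leq_trans h _)).
  rewrite /part; apply: sorted_leq_nth_geq; first by case/andP: pla.
  by move: ik; clear; lia.
have isz : i <= size la by have := partition_nth_gt0 i.-1 pla; move: ip; rewrite /part; lia.
have : i \in [seq i <- iota 1 (size la) | i <= part la i] by rewrite mem_filter ip mem_iota; lia.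
rewrite /kdiag; elim: [seq _ <- _ | _] => //= x s IH; rewrite inE leq_max => /orP[/eqP->|/IH->].
  by rewrite leqnn.
by rewrite orbT.
Qed.

Lemma mem_frob la e : is_partition la ->
  reflect (exists2 i, 0 < i <= kdiag la & e = (part la i).+1 - i) (e \in frob la).
Proof.
move=> pla; rewrite mem_filter; apply: (iffP andP) => [[e0 /(nthP 0)[i]]|[i /andP[i0 ik] ->]].
  rewrite size_arms => il; rewrite nth_arms // => eE; exists i.+1; last by rewrite /part /= -eE; lia.
  by rewrite leq_kdiag // /part /=; lia.
have ip := ik; rewrite leq_kdiag // in ip; split; first by lia.
have isz : i <= size la by have := partition_nth_gt0 i.-1 pla; move: ip; rewrite /part; lia.
by apply/(nthP 0); exists i.-1; rewrite ?size_arms ?nth_arms /part; lia.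
Qed.

Lemma is_BGE p la : is_BG p la = [&& is_partition la, self_conj la & bg_arms p (frob la)].
Proof.
rewrite /is_BG; case: (boolP (is_partition la)) => //= pla.
case: (boolP (self_conj la)) => //= /eqP sla.
have hookE i : 0 < i <= kdiag la -> hook la i i = 2 * ((part la i).+1 - i) - 1.
  by case/andP=> i0; rewrite leq_kdiag // /hook sla; lia.
apply/allP/allP => h.
  move=> e /(mem_frob _ pla)[i ik ->]; rewrite -hookE //; apply: h.
  by rewrite mem_iota; lia.
move=> i; rewrite mem_iota add1n ltnS => ik; rewrite hookE //; apply: h.
by apply/mem_frob => //; exists i.
Qed.

(** The counterpart of [mstep]: with [a] tied to [r], a single interval for [r] remains. *)
Definition bgstep (p : nat) (x y : nat * nat) : bool :=
  [&& 0 < x.1, x.1 + ~~ (p %| x.1) == 2 * x.2 &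
      y.2 + ~~ (p %| x.1) <= x.2 < y.2 + ~~ (p %| x.1) + p].

Fixpoint bgsymbol (p : nat) (X : seq (nat * nat)) : bool :=
  if X is x :: X' then bgstep p x (head (0, 0) X') && bgsymbol p X' else true.

Lemma bg_range p e s : 0 < p -> 0 < e -> all (leq 1) s -> path gtn e s ->
  let l := shift p e s in let r := cost_of p [seq y <- l | 0 < y] + zeros l in
  r <= cost p e s < r + p.
Proof.
move=> p0 e0 s0 es /=; set l := shift p e s; pose C := e + p + head 0 [seq y <- l | 0 < y].
have C0 : 0 < C by rewrite /C; lia.
have eC : e <= C + p by rewrite /C; lia.
have := range_positive p0 e0 s0 es C0 eC; rewrite /= -/l -/(zeros l).
have -> : e <= C by rewrite /C; lia.
have -> : cost p C [seq y <- l | 0 < y] = p + cost_of p [seq y <- l | 0 < y].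
  rewrite /C; case: [seq _ <- _ | _] => [|y t] /=; first by lia.
  by rewrite ifT //; lia.
by move: (cost _ _ _) (cost_of _ _) (zeros l) => a b c; clear; lia.
Qed.

Lemma dvdn_arm_addr p y : 0 < y -> (p %| 2 * (y + p) - 1) = (p %| 2 * y - 1).
Proof.
move=> y0; rewrite (_ : 2 * (y + p) - 1 = 2 * p + (2 * y - 1)); last by lia.
by rewrite dvdn_addr // dvdn_mull.
Qed.

Lemma mem_shift_or p c s y : 0 < y -> y \in shift p c s ->
  (y \in c :: s) || (y + p \in c :: s).
Proof.
move=> y0; elim: s c => [|x s IH] c /=; first by rewrite !inE; lia.
case: ifP => h; rewrite inE => /orP[/eqP->|].
- by rewrite subnK ?mem_head ?orbT //; lia.
- by move/IH; rewrite !inE => /orP[->|->]; rewrite ?orbT.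
- by rewrite !inE eqxx orbT.
- by move/IH; rewrite !inE; do ![case: (_ == _) => //=]; do ![case: (_ \in _) => //=].
Qed.

(** If [0] is in the image, the cost is [b] modulo [p] for an arm number [b], so [a = 2 cost - 1] is
    [2 b - 1] modulo [p], nonzero by the hook condition. Otherwise [p] divides the cost and
    [a = 2 cost]. *)
Lemma bg_step_down p e s a : prime p -> odd p -> 0 < e -> all (leq 1) s -> path gtn e s ->
    bg_arms p (e :: s) -> a + zeros (shift p e s) = 2 * cost p e s -> 0 < a ->
  let es := [seq y <- shift p e s | 0 < y] in
  [/\ bg_arms p es, zeros (shift p e s) = ~~ (p %| a) &
     forall b, bgstep p (a, cost p e s) (b, cost_of p es)].
Proof.
move=> hp ho e0 s0 es bg aE a0 fs; have p0 := prime_gt0 hp.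
have bg' : bg_arms p fs.
  apply/allP => y; rewrite mem_filter => /andP[y0 /(mem_shift_or y0)/orP[yl|yl]].
    exact: (allP bg).
  by rewrite -dvdn_arm_addr //; apply: (allP bg).
have zE : zeros (shift p e s) = ~~ (p %| a).
  have epe : e - p < e by lia.
  have [_ zE] := zerosE (path_sorted (path_shift p0 s0 epe es)).
  rewrite zE in aE *; case: (boolP (0 \in _)) aE => [z0|/dvdn_cost pc] /= aE.
    have [b bs [bp [m mE]]] := mod_cost p0 s0 es z0.
    have b0 : 0 < b by move: bs; rewrite inE => /orP[/eqP->//|/(allP s0)].
    have -> : a = 2 * m * p + (2 * b - 1) by move: aE b0; rewrite mE; clear; lia.
    by rewrite dvdn_addr ?dvdn_mull // (allP bg).
  by rewrite (_ : a = 2 * cost p e s) ?dvdn_mull //; move: aE; clear; lia.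
split=> // b; rewrite /bgstep /= a0 -zE aE eqxx /=.
exact: bg_range.
Qed.

Lemma bg_step_up p es a r b : prime p -> odd p -> sorted gtn es -> all (leq 1) es ->
    bg_arms p es -> bgstep p (a, r) (b, cost_of p es) ->
  exists e s, [/\ path gtn e s, all (leq 1) (e :: s), bg_arms p (e :: s), cost p e s = r &
    [seq y <- shift p e s | 0 < y] = es /\ zeros (shift p e s) = ~~ (p %| a)].
Proof.
move=> hp ho es1 es0 bg /and3P[/= a0 /eqP aE rr]; have p0 := prime_gt0 hp.
(* A [0] is put back exactly when [p] does not divide [a]. *)
pose l := es ++ nseq (~~ (p %| a)) 0.
have r0 : 0 < r by lia.
have pr : p %| a -> p %| r.
  move=> pa; move: aE; rewrite pa addn0 => aE.
  move: pa; rewrite aE Euclid_dvdM // dvdn_prime2 // => /orP[/eqP p2|//].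
  by rewrite p2 in ho.
have tE : p %| a -> res p r = p by move=> pa; apply/eqP; rewrite res_eq_dvdn // pr.
have tb := res_bounds r p0.
have lN : l != [::].
  rewrite /l; case: (boolP (p %| a)) => pa /=; last by case: (es).
  rewrite cats0; apply/eqP => eN; move: rr; rewrite eN pa /= => rr.
  by have := pr pa; rewrite gtnNdvd //; move: rr; clear; lia.
have ls : sorted gtn l.
  rewrite /l; case: (p %| a) => /=; first by rewrite cats0.
  rewrite cats1; case: (es) es1 es0 => // x t /= xt xt0.
  rewrite rcons_path xt /=.
  by have /allP/(_ _ (mem_last x t)) : all (leq 1) (x :: t) := xt0.
have ll : ~~ (p %| a) -> last 0 l = 0 by rewrite /l => ->; rewrite cats1 last_rcons.
have tl : res p r < p -> last 0 l = 0.
  by move=> h; apply: ll; apply/negP => /tE e; move: h; rewrite e ltnn.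
pose Q y := (0 < y) && ~~ (p %| 2 * y - 1).
have meml y : 0 < y -> y \in l -> y \in es.
  by move=> y0; rewrite mem_cat mem_nseq => /orP[//|/andP[_ /eqP yE]]; rewrite yE in y0.
have Ql y : 0 < y -> y \in l -> Q y && Q (y + p).
  move=> y0 /(meml _ y0) ye; rewrite /Q y0 dvdn_arm_addr // (allP bg _ ye).
  by rewrite addn_gt0 y0.
(* The hook condition for the last chain element. If [p] divides [a], that element is an old arm
   number plus [p]; if not, it is the residue [t] of [r], and [2 t - 1] agrees with [2 r - 1 = a]
   modulo [p]. *)
have Qt : Q (last 0 l + res p r).
  case: (boolP (p %| a)) => pa.
    rewrite tE //; have lm : last 0 l \in l by case: (l) lN => // x t _; apply: mem_last.
    suff l0 : 0 < last 0 l by case/andP: (Ql _ l0 lm).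
    by move: lm; rewrite {2}/l pa cats0 => /(allP es0).
  rewrite ll // add0n /Q; have /andP[-> _] /= := tb.
  have aE' : a = 2 * r - 1 by move: aE; rewrite pa; lia.
  move: pa; apply: contra => pt; rewrite aE'.
  have : r = r.-1 %/ p * p + res p r by rewrite /res addnS -divn_eq prednK.
  case: (res p r) tb pt => // t _ pt rE.
  rewrite rE; move: (r.-1 %/ p) => q.
  have -> : 2 * (q * p + t.+1) - 1 = 2 * q * p + (2 * t.+1 - 1) by clear; lia.
  by rewrite dvdn_addr // dvdn_mull.
case E: (unshift p (res p r) l) => [e s].
have [sh ps rc /andP[/andP[e0 be] Qs]] := unshiftP p0 tb lN ls tl Ql Qt E.
have s0 : all (leq 1) s by apply: sub_all Qs => x /andP[].
have bgE : bg_arms p (e :: s).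
  by rewrite /bg_arms /= be; apply: sub_all Qs => x /andP[].
have fE : [seq y <- l | 0 < y] = es.
  rewrite /l filter_cat (all_filterP es0) (_ : filter _ _ = [::]) ?cats0 //.
  by case: (p %| a).
have zE : zeros l = ~~ (p %| a) by rewrite /zeros fE size_cat size_nseq addKn.
have rg := bg_range p0 e0 s0 ps; rewrite /= sh fE zE in rg.
exists e, s; split=> //; first by rewrite /= e0.
  apply: (res_inj _ r0 rg _ rc); first exact: cost_gt0.
  exact: rr.
by rewrite sh.
Qed.

Lemma BG_symbol_ind p (P : seq nat -> Prop) : prime p -> odd p -> P [::] ->
  (forall la e s a, is_BG p la -> frob la = e :: s -> path gtn e s -> all (leq 1) (e :: s) ->
    let es := [seq y <- shift p e s | 0 < y] in
    is_BG p (unfrob es) -> frob (unfrob es) = es ->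
    sumn la = a + sumn (unfrob es) ->
    zeros (shift p e s) = ~~ (p %| a) -> (forall b, bgstep p (a, cost p e s) (b, cost_of p es)) ->
    BG_symbol p la = (a, cost p e s) :: BG_symbol p (unfrob es) ->
    P (unfrob es) -> P la) ->
  forall la, is_BG p la -> P la.
Proof.
move=> hp ho P0 Pstep la; have [n] := ubnP (sumn la); elim: n la => // n IH la lan bla.
have p1 := prime_gt1 hp; have p0 := ltnW p1.
have /and3P[pla sla bg] : [&& is_partition la, self_conj la & bg_arms p (frob la)] by rewrite -is_BGE.
case E: (frob la) => [|e s]; first by rewrite (frob_nil pla E).
have [a [h1 h2 h3 h4]] := BG_symbolE p1 pla sla E.
have /andP[es es0] := frob_strict pla; rewrite E in es es0 bg.
have /andP[e0 s0] := es0.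
have [f1 f2] := shift_filter_strict p0 e0 s0 es.
have [pmu smu hmu _ _] := unfrobP f1 f2.
have [g1 g2 g3] := bg_step_down hp ho e0 s0 es bg h2 h4.
have bmu : is_BG p (unfrob [seq y <- shift p e s | 0 < y]).
  by rewrite is_BGE pmu smu hmu.
by apply: (Pstep la e s a) => //; apply: IH => //; move: lan; rewrite h3; move: h4; clear; lia.
Qed.

Lemma snd_head_BG_symbol p la : prime p -> odd p -> is_BG p la ->
  (head (0, 0) (BG_symbol p la)).2 = cost_of p (frob la).
Proof.
move=> hp ho; move: la.
by apply: (BG_symbol_ind hp ho) => // la e s a _ -> _ _ es _ _ _ _ _ -> _.
Qed.

Lemma bgsymbol_BG p la : prime p -> odd p -> is_BG p la -> bgsymbol p (BG_symbol p la).
Proof.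
move=> hp ho; move: la.
apply: (BG_symbol_ind hp ho) => // la e s a bla E es es0 fs bmu hmu h1 h2 st -> IH /=.
have sh := snd_head_BG_symbol hp ho bmu; rewrite hmu in sh.
by have := st (head (0, 0) (BG_symbol p (unfrob fs))).1; rewrite -sh -surjective_pairing IH andbT.
Qed.

Lemma sumn_BG_symbol p la : prime p -> odd p -> is_BG p la ->
  sumn la = sumn (unzip1 (BG_symbol p la)).
Proof.
move=> hp ho; move: la.
by apply: (BG_symbol_ind hp ho) => // la e s a _ _ _ _ fs _ _ -> _ _ -> ->.
Qed.

Lemma BG_symbol_inj p la mu : prime p -> odd p -> is_BG p la -> is_BG p mu ->
  BG_symbol p la = BG_symbol p mu -> la = mu.
Proof.
move=> hp ho bla; move: la bla mu.
apply: (BG_symbol_ind hp ho) => [|la e s a bla E es es0 fs bnu hnu h1 z1 st eq1 IH] mu bmu.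
  by move: mu bmu; apply: (BG_symbol_ind hp ho) => // mu e s a _ _ _ _ fs _ _ _ _ _ ->.
move: mu bmu; apply: (BG_symbol_ind hp ho).
  by rewrite eq1.
move=> mu e' s' a' bmu E' es' es0' fs' bnu' hnu' h1' z1' st' eq2 _.
rewrite eq1 eq2 => -[aa cc /(IH _ bnu') nuE].
have fE : fs = fs' by rewrite -hnu nuE hnu'.
have p0 := prime_gt0 hp.
have /andP[e0 s0] := es0; have /andP[e0' s0'] := es0'.
have ee : e - p < e by lia.
have ee' : e' - p < e' by lia.
have [l1 _] := zerosE (path_sorted (path_shift p0 s0 ee es)).
have [l2 _] := zerosE (path_sorted (path_shift p0 s0' ee' es')).
(* Whether the image ends in [0] is read off from the divisibility of [a]. *)
have lE : shift p e s = shift p e' s'.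
  by rewrite l1 l2 z1 z1' aa -/fs -/fs' fE.
have := shiftK p0 e0' s0' es'; rewrite -cc -lE shiftK // => -[eE sE].
have /and3P[pla sla _] : [&& is_partition la, self_conj la & bg_arms p (frob la)] by rewrite -is_BGE.
have /and3P[pmu smu _] : [&& is_partition mu, self_conj mu & bg_arms p (frob mu)] by rewrite -is_BGE.
by apply: self_conj_ext => //; rewrite E E' eE sE.
Qed.

Lemma bgsymbol_exists p X : prime p -> odd p -> bgsymbol p X ->
  exists2 la, is_BG p la & BG_symbol p la = X.
Proof.
move=> hp ho; elim: X => [|[a r] X IH] /=; first by exists [::].
case/andP=> st /IH[nu bnu nuE].
have /and3P[pnu snu bg] : [&& is_partition nu, self_conj nu & bg_arms p (frob nu)] by rewrite -is_BGE.
have /andP[f1 f2] := frob_strict pnu.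
have st' : bgstep p (a, r) ((head (0, 0) X).1, cost_of p (frob nu)).
  by rewrite -snd_head_BG_symbol // nuE -surjective_pairing.
have [e [s [es es0 be cE [fE zE]]]] := bg_step_up hp ho f1 f2 bg st'.
have [pla sla hla _ _] := @unfrobP (e :: s) es es0.
exists (unfrob (e :: s)); first by rewrite is_BGE pla sla hla.
have [b [-> h2 _ b0]] := BG_symbolE (prime_gt1 hp) pla sla hla.
have nE : unfrob (frob nu) = nu.
  by have [h3 h4 h5 _ _] := unfrobP f1 f2; apply: self_conj_ext.
rewrite fE nE nuE cE; congr ((_, _) :: _).
move: h2; rewrite zE cE; case/and3P: st => /= _ /eqP <- _; exact: addIn.
Qed.

(** * Comparison of the two kinds of symbols *)

(** With [a + eps = 2 r] in a column and in the next one [(a', r')], the bounds on [a] in [mstep]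
    become [r' + eps <= r < r' + eps + p], the same as those on [r]. The default column [(0, 0)]
    satisfies the relation, as [p] divides [0]. *)
Lemma bgsymbol_msymbol p X :
  bgsymbol p X = msymbol p X && all (fun c => c.1 + ~~ (p %| c.1) == 2 * c.2) X.
Proof.
elim: X => //= x X ->.
case: (msymbol p X); case dX : (all _ X); rewrite ?andbT ?andbF //= /bgstep /mstep.
have : let y := head (0, 0) X in y.1 + ~~ (p %| y.1) == 2 * y.2.
  by case: X dX => [|y X] /= => [_|/andP[]//]; rewrite dvdn0.
case: (head _ _) => a' r' /=; case: x => a r /=.
case: (p %| a) (p %| a') => -[] /=; lia.
Qed.

(** Being fixed by the Mullineux map means [r = a + eps - r] in every column. *)
Lemma self_mullineuxE p la : 1 < p ->
  self_mullineux p la = p_regular p la && bgsymbol p (mull_symbol p la).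
Proof.
move=> p1; rewrite /self_mullineux /is_mullineux_image; case: (boolP (p_regular p la)) => //= rla.
rewrite bgsymbol_msymbol msymbol_mull // /mull_dual_symbol /=.
have : all (fun c : nat * nat => 0 < c.1) (mull_symbol p la).
  have := msymbol_mull p1 rla; elim: (mull_symbol p la) => //= c X IH /andP[/and3P[-> _ _] /IH //].
elim: (mull_symbol p la) => //= -[a r] X IH /andP[/= a0 /IH <-].
rewrite eqseq_cons; congr (_ && _); rewrite xpair_eqE eqxx /=.
by case: (p %| a) => /=; lia.
Qed.

Unset Implicit Arguments.

Theorem theorem3p15 (p : nat) (hp : prime p) (hodd : odd p) :
  (* equality of the two sets of symbols *)
  (forall X : seq (nat * nat),
     (exists la, is_BG p la /\ BG_symbol p la = X) <->
     (exists mu, self_mullineux p mu /\ mull_symbol p mu = X)) /\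
  (* the map Phi : la |-> the unique p-regular mu with G_p(mu) = BG_p(la)
     is well defined on BG-partitions ... *)
  (forall la, is_BG p la ->
     exists! mu, p_regular p mu /\ mull_symbol p mu = BG_symbol p la) /\
  (* ... lands in self-Mullineux partitions ... *)
  (forall la mu, is_BG p la -> p_regular p mu ->
     mull_symbol p mu = BG_symbol p la -> self_mullineux p mu) /\
  (* ... and is a bijection onto them *)
  (forall mu, self_mullineux p mu ->
     exists! la, is_BG p la /\ BG_symbol p la = mull_symbol p mu) /\
  (* for every n it restricts to a bijection between BG-partitions of n and
     self-Mullineux partitions of n *)
  (forall n la mu, is_BG p la -> sumn la = n -> p_regular p mu ->
     mull_symbol p mu = BG_symbol p la -> sumn mu = n) /\
  (forall n mu, self_mullineux p mu -> sumn mu = n ->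
     exists! la, [/\ is_BG p la, sumn la = n & BG_symbol p la = mull_symbol p mu]).
Proof.
have p1 := prime_gt1 hp.
(* A BG-symbol satisfies the inequalities of Mullineux symbols, hence is one. *)
have toM la : is_BG p la -> exists2 mu, p_regular p mu & mull_symbol p mu = BG_symbol p la.
  by move/(bgsymbol_BG hp hodd); rewrite bgsymbol_msymbol => /andP[/(msymbol_exists p1)].
have selfM la mu : is_BG p la -> p_regular p mu -> mull_symbol p mu = BG_symbol p la ->
    self_mullineux p mu.
  by move=> bla rmu e; rewrite self_mullineuxE // rmu e bgsymbol_BG.
have toBG mu : self_mullineux p mu -> exists2 la, is_BG p la & BG_symbol p la = mull_symbol p mu.
  by rewrite self_mullineuxE // => /andP[_ /(bgsymbol_exists hp hodd)].
(* The top row of either kind of symbol sums to the size of the partition. *)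
have sumE la mu : is_BG p la -> p_regular p mu -> mull_symbol p mu = BG_symbol p la ->
    sumn mu = sumn la.
  by move=> bla rmu e; rewrite (sumn_mull_symbol p1 rmu) e -sumn_BG_symbol.
split=> [X|].
  split=> [[la [bla <-]]|[mu [smu <-]]].
    by have [mu rmu e] := toM la bla; exists mu; split=> //; apply: selfM e.
  by have [la bla e] := toBG mu smu; exists la.
split=> [la bla|].
  have [mu rmu e] := toM la bla; exists mu; split=> // nu [rnu e'].
  by apply: (mull_symbol_inj p1) => //; rewrite e e'.
split=> [//|].
have inj mu la la' : is_BG p la -> BG_symbol p la = mull_symbol p mu ->
    is_BG p la' -> BG_symbol p la' = mull_symbol p mu -> la = la'.
  by move=> bla e bla' e'; apply: (BG_symbol_inj hp hodd) => //; rewrite e e'.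
split=> [mu smu|].
  have [la bla e] := toBG mu smu; exists la; split=> // la' [bla' e'].
  exact: inj e _ e'.
split=> [n la mu bla <- rmu e|n mu smu nE]; first exact: sumE.
have [la bla e] := toBG mu smu; have rmu : p_regular p mu by case/andP: smu.
exists la; split=> [|la' [bla' _ e']]; last exact: inj e _ e'.
by split=> //; rewrite -nE; apply/esym/sumE.
Qed.
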